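(* Consider the MDP $(\mathbb{X},\mathbb{U},\mathcal{T},c)$, with $\mathbb{X}$ compact of diameter $D$ and $\mathbb{U}$ finite, and the approximate MDP $(\mathbb{X},\mathbb{U},\hat{\mathcal{T}},\hat c)$ built from a quantization of $\mathbb{X}$ with quantization error $L_{\mathbb{X}}$ (all defined in the context). Let $\hat\pi:\mathbb{X}\to\mathbb{U}$ be a stationary policy that is optimal for the approximate model and satisfies the average cost optimality equation of the approximate model. Let $J(x_0,\hat\pi)$ be the average cost of $\hat\pi$ in the original MDP, $J^*(x_0)$ the optimal average cost of the original MDP, and $\hat J(x_0)$ the optimal average cost of the approximate MDP, from initial state $x_0\in\mathbb{X}$. Under the Minorization Condition (defined in the context) these values are independent of the initial state, and one writes $\rho(\hat\pi):=J(x_0,\hat\pi)$, $\hat\rho:=\hat J(x_0)$, $\rho:=J^*(x_0)$ for all $x_0\in\mathbb{X}$. The following hold. (i) Under the Lipschitz Condition (defined in the context) with $K_{\mathcal{T}}<1$, $J^*(x_0)=\rho$ does not depend on $x_0$ and, for every $x_0\in\mathbb{X}$, $$|\rho-\hat J(x_0)|\le \frac{K_c}{1-K_{\mathcal{T}}}L_{\mathbb{X}}.$$ (ii) Under the Minorization Condition with measure $\nu$ such that $\kappa:=1-\nu(\mathbb{X})>0$, and the Lipschitz Condition, for every $\delta\in(0,1]$ with $K_{\mathcal{T}}<\left(\frac1\kappa\right)^{\frac{1-\delta}{\delta}}$, $$|\rho-\hat\rho|\le \frac{K_cD^{1-\delta}}{1-K_{\mathcal{T}}^{\delta}\kappa^{1-\delta}}\,(L_{\mathbb{X}})^{\delta},$$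 and furthermore $$\rho(\hat\pi)-\rho\le \frac{2K_cD^{1-\delta}}{(1-\kappa)\left(1-K_{\mathcal{T}}^{\delta}\kappa^{1-\delta}\right)}\,(L_{\mathbb{X}})^{\delta}.$$ (iii) Suppose the Minorization Condition holds with measure $\nu$ such that $\kappa=1-\nu(\mathbb{X})>0$, and the Weak Continuity Condition (defined in the context) holds. For each $n\ge1$ take a quantization (and weight measure) with $L_{\mathbb{X}}=\frac1n$, and let $\pi_n$ be a policy that is optimal for, and satisfies the average cost optimality equation of, the corresponding approximate model. Then $\lim_{n\to\infty}\rho(\pi_n)=\rho$, where $\rho(\pi_n)$ is the average cost of $\pi_n$ in the original MDP.
   Context: MDP. $(\mathbb{X},d_{\mathbb{X}})$ is a complete separable metric state space, $\mathbb{U}$ a finite action space, $\mathcal{T}(dx_1|x,u)$ a stochastic kernel on $\mathbb{X}$ given $\mathbb{X}\times\mathbb{U}$, $c:\mathbb{X}\times\mathbb{U}\to\mathbb{R}$ a measurable one-stage cost. Admissible policies are (possibly randomized) history-dependent measurable policies; the average cost is $J(x,\pi)=\limsup_{T\to\infty}\frac1T E^\pi_x\left[\sum_{t=0}^{T-1}c(X_t,U_t)\right]$ and $J^*(x)=\inf_\pi J(x,\pi)$ over admissible policies. Approximate model. $\{B_i\}_{i=1}^M$ is a finite partition of $\mathbb{X}$ into Borel bins; $\mu$ is a probability (weight) measure on $\mathbb{X}$ with $\mu(B_i)>0$ for all $i$; $y_i\in B_i$ are representative states, and $\mu_{y_i}(A)=\mu(A)/\mu(B_i)$ for Borel $A\subset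 B_i$. For $x\in B_i$, $$\hat c(x,u)=\int_{B_i}c(z,u)\mu_{y_i}(dz),\qquad \hat{\mathcal{T}}(A|x,u)=\int_{B_i}\mathcal{T}(A|z,u)\mu_{y_i}(dz).$$ $\hat J(x)$ is the optimal average cost from $x$ of the MDP $(\mathbb{X},\mathbb{U},\hat{\mathcal{T}},\hat c)$. A policy $\hat\pi$ satisfies the average cost optimality equation of the approximate model if there are a constant $\hat\rho$ and a bounded measurable $\hat h$ with, for all $x$, $$\hat\rho+\hat h(x)=\hat c(x,\hat\pi(x))+\int\hat h(x_1)\hat{\mathcal{T}}(dx_1|x,\hat\pi(x))=\min_{u\in\mathbb{U}}\left\{\hat c(x,u)+\int\hat h(x_1)\hat{\mathcal{T}}(dx_1|x,u)\right\}.$$ Quantization error. For $x\in B_i$, $L(x)=\int_{B_i}d_{\mathbb{X}}(x,x')\mu_{y_i}(dx')$, and $L_{\mathbb{X}}=\sup_{x}L(x)$. Minorization Condition: there is a positive measure $\nu$ on $\mathbb{X}$ with $\nu(\mathbb{X})>0$ and $\mathcal{T}(B|x,u)\ge\nu(B)$ for all Borel $B$ and all $(x,u)$. Lipschitz Condition: $\mathbb{X}$ is compact, $\mathbb{U}$ is finite, and there are finite constants $K_c,K_{\mathcal{T}}$ such that for all $x,x',u$: $|c(x,u)-c(x',u)|\le K_cd_{\mathbb{X}}(x,x')$ and $W_1(\mathcal{T}(\cdot|x,u),\mathcal{T}(\cdot|x',u))\le K_{\mathcal{T}}d_{\mathbb{X}}(x,x')$, where $W_1$ is the first-order Wasserstein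 distance. Weak Continuity Condition: $\mathbb{U}$ is finite, $\mathbb{X}$ is compact, $c$ is bounded and continuous, and $\mathcal{T}(\cdot|x,u)$ is weakly continuous in $(x,u)$, i.e. $\mathcal{T}(\cdot|x_n,u_n)\to\mathcal{T}(\cdot|x,u)$ weakly whenever $(x_n,u_n)\to(x,u)$. *)

(* Defs.v *)
From HB Require Import structures.
From mathcomp Require Import all_boot all_order all_algebra.
From mathcomp Require Import all_classical all_reals all_analysis.
From mathcomp Require Import measurable_realfun.

Set Implicit Arguments.
Unset Strict Implicit.
Unset Printing Implicit Defensive.
Import Order.TTheory GRing.Theory Num.Theory.
Import numFieldNormedType.Exports.

Local Open Scope classical_set_scope.
Local Open Scope ring_scope.

(* Metric spaces with their Borel sigma-algebra; every measurableType is
   pointed, so they are nonempty.  Completeness and separability follow from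
   compactness wherever the latter is assumed. *)
HB.mixin Record isBorel (R : realType) d T
    & Metric R T & Measurable d T := {
  borelE : (measurable : set (set T)) = <<s open >> }.

#[short(type="borelMetricType")]
HB.structure Definition BorelMetric (R : realType) d :=
  { T of Metric R T & Measurable d T & isBorel R d T }.

Section kernel_constructions.
Local Open Scope ereal_scope.
Context {R : realType}.

Section pullback.
Context d0 d1 d2 (S : measurableType d0) (T : measurableType d1)
  (Z : measurableType d2).
Variables (f : S -> T) (mf : measurable_fun [set: S] f) (k : R.-pker T ~> Z).

Definition kpullback of measurable_fun [set: S] f :=
  fun x : S => k (f x) : {measure set Z -> \bar R}.

Let measurable_kpullback A : measurable A ->
  measurable_fun [set: S] (kpullback mf ^~ A).
Proof. by move=> mA; exact: measurableT_comp (measurable_kernel k A mA) mf. Qed.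

HB.instance Definition _ :=
  isKernel.Build _ _ _ _ R (kpullback mf) measurable_kpullback.

Let kpullbackT x : kpullback mf x [set: Z] = 1.
Proof. by rewrite /kpullback prob_kernel. Qed.

HB.instance Definition _ :=
  Kernel_isProbability.Build _ _ _ _ _ (kpullback mf) kpullbackT.

End pullback.

Section product.
Context d0 d1 d2 (S : measurableType d0) (T : measurableType d1)
  (Z : measurableType d2).
Variables (k1 : R.-pker S ~> T) (k2 : R.-pker (S * T) ~> Z).

Definition kprod (x : S) : {measure set (T * Z) -> \bar R} := mkproduct k1 k2 x.

HB.instance Definition _ :=
  isKernel.Build _ _ _ _ R kprod (measurable_kproduct k1 k2).

Let kprodT x : kprod x [set: T * Z] = 1.
Proof.
transitivity (\int[k1 x]_y (1 : \bar R)); last first.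
  by rewrite integral_cst// mul1e prob_kernel.
apply: eq_integral => y _.
rewrite -[LHS]/(\int[k2 (x, y)]_z (\1_[set: T * Z] (y, z))%:E).
rewrite indicT; have := @integral_cst _ _ R (k2 (x, y)) _ measurableT 1.
by rewrite mul1e prob_kernel.
Qed.

HB.instance Definition _ := Kernel_isProbability.Build _ _ _ _ _ kprod kprodT.

End product.

Section composition.
Context d0 d1 d2 (S : measurableType d0) (T : measurableType d1)
  (Z : measurableType d2).
Variables (k1 : R.-pker S ~> T) (k2 : R.-pker (S * T) ~> Z).

Definition kseqcomp (x : S) : {measure set Z -> \bar R} := (k1 \; k2) x.

HB.instance Definition _ :=
  isKernel.Build _ _ _ _ R kseqcomp (measurable_kernel (k1 \; k2)).

Let kseqcompT x : kseqcomp x [set: Z] = 1.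
Proof.
rewrite /kseqcomp /= /kcomp.
under eq_integral do rewrite prob_kernel.
by rewrite integral_cst// mul1e prob_kernel.
Qed.

HB.instance Definition _ :=
  Kernel_isProbability.Build _ _ _ _ _ kseqcomp kseqcompT.

End composition.

End kernel_constructions.

Record mdp (R : realType) dX dU (X : borelMetricType R dX)
    (U : measurableType dU) := MDP {
  trans : R.-pker (X * U) ~> X ;
  cost : X * U -> R ;
  measurable_cost : measurable_fun [set: X * U] cost }.

Section histories.
Context dX dU (X : measurableType dX) (U : measurableType dU).

Fixpoint hist_display (t : nat) : measure_display :=
  if t is t'.+1 then
    measure_prod_display
      (measure_prod_display (hist_display t', dU), dX)
  else dX.

(* hist t is the space of histories (x_0, u_0, ..., x_(t-1), u_(t-1), x_t). *)
Fixpoint hist (t : nat) : measurableType (hist_display t) :=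
  match t return measurableType (hist_display t) with
  | 0%N => X
  | t'.+1 => (hist t' * U * X)%type
  end.

Definition last_state (t : nat) : hist t -> X :=
  match t return hist t -> X with
  | 0%N => idfun
  | t'.+1 => snd
  end.

Lemma measurable_last_state t : measurable_fun [set: hist t] (@last_state t).
Proof. by case: t => [|t]; [exact: measurable_id|exact: measurable_snd]. Qed.

Definition last_state_action t (z : X * (hist t * U)) : X * U :=
  (last_state z.2.1, z.2.2).

Lemma measurable_last_state_action t :
  measurable_fun [set: X * (hist t * U)] (@last_state_action t).
Proof.
apply/measurable_fun_pairP; split.
  exact: (measurableT_comp (@measurable_last_state t)
    (measurableT_comp measurable_fst measurable_snd)).
exact: (measurableT_comp measurable_snd measurable_snd).
Qed.

End histories.

Section average_cost.
Context {R : realType} {dX dU : measure_display}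
  {X : borelMetricType R dX} {U : measurableType dU}.
Local Open Scope ereal_scope.

Definition policy := forall t, R.-pker (hist X U t) ~> U.

(* The law of (X_0, U_0, ..., X_t), as a kernel in the initial state:
   P_x(dx_0 du_0 ... dx_t) =
     delta_x(dx_0) pi_0(du_0|x_0) T(dx_1|x_0,u_0) pi_1(du_1|x_0,u_0,x_1) ... *)
Fixpoint hist_law (M : mdp X U) (p : policy) (t : nat) :
    R.-pker X ~> hist X U t :=
  match t return R.-pker X ~> hist X U t with
  | 0%N => kdirac (@measurable_id _ X setT)
  | t'.+1 =>
      kprod (kprod (hist_law M p t') (kpullback (p t') measurable_snd))
            (kpullback (trans M) (@measurable_last_state_action _ _ X U t'))
  end.

(* c(x_0,u_0) + ... + c(x_(t-1),u_(t-1)) *)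
Fixpoint total_cost (M : mdp X U) (t : nat) : hist X U t -> R :=
  match t return hist X U t -> R with
  | 0%N => fun=> 0%R
  | t'.+1 => fun h =>
      (total_cost M h.1.1 + cost M (last_state h.1.1, h.1.2))%R
  end.

(* The term of index T = 0 is 0, as 0^-1 = 0. *)
Definition avg_cost (M : mdp X U) (x : X) (p : policy) : \bar R :=
  limn_esup (fun T => (T%:R^-1)%:E *
    \int[hist_law M p T x]_h (total_cost M h)%:E).

Definition opt_cost (M : mdp X U) (x : X) : \bar R :=
  ereal_inf [set avg_cost M x p | p in [set: policy]].

Definition stationary (f : {mfun X >-> U}) : policy := fun t =>
  kdirac (measurableT_comp (@measurable_funPT _ _ _ _ f)
                           (@measurable_last_state _ _ X U t)).

Definition optimal (M : mdp X U) (p : policy) : Prop :=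
  forall x, avg_cost M x p = opt_cost M x.

Definition is_min (A : set R) (m : R) : Prop := A m /\ lbound A m.

Definition satisfies_ACOE (M : mdp X U) (f : X -> U) : Prop :=
  exists (rho : R) (h : X -> R),
    [/\ measurable_fun [set: X] h,
        exists C : R, forall x, (`|h x| <= C)%R
      & forall x,
          let q u := (cost M (x, u) + \int[trans M (x, u)]_x1 h x1)%R in
          (rho + h x = q (f x))%R /\ is_min (range q) (rho + h x)%R].

End average_cost.
Arguments policy {R dX dU} X U.

Record quantization (R : realType) dX (X : borelMetricType R dX) :=
  Quantization {
  nbins : nat ;
  bin : 'I_nbins -> set X ;
  measurable_bin : forall i, measurable (bin i) ;
  trivIset_bin : trivIset [set: 'I_nbins] bin ;
  cover_bin : \bigcup_i bin i = [set: X] ;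
  weight : probability X R ;
  weight_gt0 : forall i, (0 < weight (bin i))%E ;
  repr_state : 'I_nbins -> X ;
  repr_state_bin : forall i, bin i (repr_state i) }.
Arguments bin {R dX X} q i.
Arguments repr_state {R dX X} q i.

Section approximate_model.
Context {R : realType} {dX dU : measure_display}
  {X : borelMetricType R dX} {U : measurableType dU}.

Lemma exists_bin (Q : quantization X) (x : X) : exists i, bin Q i x.
Proof.
have : [set: X] x by [].
by rewrite -(cover_bin Q) => -[i _ Qix]; exists i.
Qed.

Definition bin_index (Q : quantization X) (x : X) : 'I_(nbins Q) :=
  xget (sval (cid (exists_bin Q x))) [set i | bin Q i x].

Lemma bin_indexP (Q : quantization X) x : bin Q (bin_index Q x) x.
Proof. by rewrite /bin_index; case: cid => i Qi /=; case: xgetP => //=. Qed.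

Lemma bin_indexE (Q : quantization X) x i : bin Q i x -> bin_index Q x = i.
Proof.
by move=> Qix; apply: (trivIset_bin (q := Q)) => //; exists x; split => //;
  exact: bin_indexP.
Qed.

(* A |-> mu(A `&` B_i) / mu(B_i), extended to the whole space and carried by
   B_i, so that integrals over the space are integrals over B_i.  The last
   argument of mnormalize is a default for weightless bins, which weight_gt0
   excludes. *)
Definition bin_measure (Q : quantization X) (i : 'I_(nbins Q)) :
    probability X R :=
  mnormalize (mrestr (weight Q) (@measurable_bin _ _ _ Q i)) (weight Q).
Arguments bin_measure : clear implicits.

Lemma bin_measureE (Q : quantization X) i A :
  bin_measure Q i A =
  (weight Q (A `&` bin Q i) * (fine (weight Q (bin Q i)))^-1%:E)%E.
Proof.
rewrite /bin_measure /= /mnormalize /= /mrestr setTI.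
have := weight_gt0 (q := Q) i; rewrite lt0e => /andP[/negbTE -> _].
have -> // : (weight Q (bin Q i) == +oo)%E = false.
apply/negbTE; have := fin_num_measure (weight Q) _ (@measurable_bin _ _ _ Q i).
by rewrite fin_numE => /andP[].
Qed.

Definition bin_kernel (Q : quantization X) (xu : X * U) :
    {measure set X -> \bar R} := bin_measure Q (bin_index Q xu.1).

Lemma measurable_bin_kernel Q A : measurable A ->
  measurable_fun [set: X * U] (bin_kernel Q ^~ A).
Proof.
move=> mA _ B mB; rewrite setTI.
rewrite [X in measurable X](_ : _ =
  \bigcup_(i in [set i | B (bin_measure Q i A)]) (bin Q i `*` [set: U])).
  by apply: fin_bigcup_measurable => // i _; apply: measurableX => //;
    exact: measurable_bin.
apply/seteqP; split=> [[x u] /= Bx|[x u] [i /= Bi [/= Qix _]]].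
  by exists (bin_index Q x) => //; split => //; exact: bin_indexP.
by rewrite /bin_kernel /= (bin_indexE Qix).
Qed.

HB.instance Definition _ Q :=
  isKernel.Build _ _ _ _ R (bin_kernel Q) (@measurable_bin_kernel Q).

Lemma bin_kernelT Q xu : bin_kernel Q xu [set: X] = 1%E.
Proof. exact: probability_setT. Qed.

HB.instance Definition _ Q :=
  Kernel_isProbability.Build _ _ _ _ _ (bin_kernel Q) (@bin_kernelT Q).

Definition replace_state (z : X * U * X) : X * U := (z.2, z.1.2).

Lemma measurable_replace_state :
  measurable_fun [set: X * U * X] replace_state.
Proof.
apply/measurable_fun_pairP; split; first exact: measurable_snd.
exact: (measurableT_comp measurable_snd measurable_fst).
Qed.

Definition approx_trans (M : mdp X U) (Q : quantization X) :
    R.-pker (X * U) ~> X :=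
  kseqcomp (bin_kernel Q) (kpullback (trans M) measurable_replace_state).

Lemma approx_transE M Q x u (A : set X) :
  approx_trans M Q (x, u) A =
  (\int[bin_measure Q (bin_index Q x)]_z trans M (z, u) A)%E.
Proof. by []. Qed.

Definition approx_cost (M : mdp X U) (Q : quantization X) (xu : X * U) : R :=
  \int[bin_measure Q (bin_index Q xu.1)]_z cost M (z, xu.2).

Lemma measurable_approx_cost M Q :
  measurable_fun [set: X * U] (approx_cost M Q).
Proof.
pose g (z : X * U * X) := (cost M (replace_state z))%:E.
have mg : measurable_fun [set: X * U * X] g.
  apply/measurable_EFinP.
  exact: (measurableT_comp (measurable_cost M) measurable_replace_state).
apply: (measurableT_comp (fine_measurable measurableT)).
rewrite [X in measurable_fun _ X](_ : _ = (fun xu =>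
    \int[bin_kernel Q xu]_z g^\+ (xu, z) - \int[bin_kernel Q xu]_z g^\- (xu, z))%E).
  apply: emeasurable_funB.
  - apply: (measurable_fun_integral_finite_kernel (g^\+)%E (bin_kernel Q)) => //.
    exact: measurable_funepos.
  - apply: (measurable_fun_integral_finite_kernel (g^\-)%E (bin_kernel Q)) => //.
    exact: measurable_funeneg.
apply/funext => -[x u] /=; rewrite integralE.
by congr (_ - _)%E; apply: eq_integral => z _; rewrite ?funeposE ?funenegE.
Qed.

Definition approx_mdp (M : mdp X U) (Q : quantization X) : mdp X U :=
  MDP (approx_trans M Q) (measurable_approx_cost M Q).

Definition quant_err (Q : quantization X) (x : X) : R :=
  \int[bin_measure Q (bin_index Q x)]_x' mdist x x'.

Definition max_quant_err (Q : quantization X) : R := sup (range (quant_err Q)).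

End approximate_model.
Arguments bin_measure {R dX X} Q i.

Section conditions.
Context {R : realType} {dX dU : measure_display}
  {X : borelMetricType R dX} {U : measurableType dU}.
Local Open Scope ereal_scope.

Definition diameter : R := sup (range (fun z : X * X => mdist z.1 z.2)).

Definition is_coupling (m1 m2 : set X -> \bar R) (g : probability (X * X)%type R) :=
  forall A, measurable A -> g (A `*` setT) = m1 A /\ g (setT `*` A) = m2 A.

Definition wasserstein1 (m1 m2 : set X -> \bar R) : \bar R :=
  ereal_inf [set \int[g]_z (mdist z.1 z.2)%:E | g in is_coupling m1 m2].

(* nu is finite, being dominated by a probability measure. *)
Definition minorization (M : mdp X U) (nu : {measure set X -> \bar R}) : Prop :=
  0 < nu [set: X] /\
  forall xu B, measurable B -> nu B <= trans M xu B.

Definition lipschitz_condition (M : mdp X U) (Kc KT : R) : Prop :=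
  [/\ compact [set: X],
      finite_set [set: U],
      forall x x' u, (`|cost M (x, u) - cost M (x', u)| <= Kc * mdist x x')%R
    & forall x x' u,
        wasserstein1 (trans M (x, u)) (trans M (x', u)) <= (KT * mdist x x')%:E].

(* Convergence in X * U for the discrete topology on U. *)
Definition cvg_state_action (z : nat -> X * U) (xu : X * U) : Prop :=
  (fst \o z @ \oo --> xu.1) /\ (\forall n \near \oo, (z n).2 = xu.2).

Definition weak_cvg (m : nat -> {measure set X -> \bar R})
    (l : {measure set X -> \bar R}) : Prop :=
  forall f : X -> R, continuous f -> (exists C : R, forall x, (`|f x| <= C)%R) ->
    (\int[m n]_x (f x)%:E @[n --> \oo] --> \int[l]_x (f x)%:E).

Definition weak_continuity_condition (M : mdp X U) : Prop :=
  [/\ finite_set [set: U],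
      compact [set: X],
      exists C : R, forall xu, (`|cost M xu| <= C)%R,
      forall z xu, cvg_state_action z xu ->
        cost M (z n) @[n --> \oo] --> cost M xu
    & forall z xu, cvg_state_action z xu ->
        weak_cvg (fun n => trans M (z n)) (trans M xu)].

End conditions.
Arguments diameter {R dX} X.

(* Main.v *)
Require Import Defs.
From HB Require Import structures.
From mathcomp Require Import all_boot all_order all_algebra.
From mathcomp Require Import all_classical all_reals all_analysis.
From mathcomp Require Import measurable_realfun.
From mathcomp Require Import ring lra.

(** Write q_h(x,u) = c(x,u) + int h dT(x,u).  If h is bounded and
    rho + h(x) <= q_h(x,u) for all x and u, then summing the inequality along a
    trajectory shows that every policy has average cost at least rho; if
    q_h(x,f(x)) <= rho + h(x), the stationary policy f has average cost at most
    rho.  As this survives an error e in the inequalities, exact solutions of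
    the optimality equation are never constructed: for every e > 0 a solution
    with error e is enough (approx_ACOE), and it is a discounted value iterate
    with discount factor close to 1, as soon as the iterates have uniformly
    bounded span (exists_approx_ACOE).

    The quantized model averages q_h over bins, so an approximate solution h of
    the original model, taken with the same rho and the same policy f, solves
    the quantized model up to the oscillation E of q_h over a bin.  Hence the
    two optimal costs differ by at most E (opt_cost_gap).

    Under the Lipschitz condition all iterates are delta-Hoelder with constant
    K = Kc D^(1-delta) / (1 - KT^delta k^(1-delta)), k = 1 - nu(X), and then so
    is q_h, whence E <= K L^delta by Jensen.  This rests on the contraction
    |int h dT(x,u) - int h dT(x',u)|
      <= K k^(1-delta) (KT d(x,x'))^delta (hoelder_mean_gap):
    h is the sum of a Lipschitz function, whose means W1 controls, and of a
    small nonnegative remainder, whose means can only differ outside the common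
    part nu.  It replaces an optimal coupling of the measures T - nu and so the
    Kantorovich-Rubinstein duality.  The bound
    under KT < 1 is the case nu = 0, delta = 1.

    For the policy f of the quantized model, its exact relative value function
    h' satisfies span(h' - h) <= 2 E / (1 - k), because that model contracts
    spans by k.  Carrying this through one comparison of actions bounds
    q_h(x,f(x)) - h(x) by rho + 2 E / (1 - k) (avg_cost_transfer), and the
    average cost of f in the original model is bounded accordingly.  Under
    weak continuity h is continuous, q_h is uniformly continuous, and E is at
    most e + C L for arbitrary e > 0, so the same bound yields the limit. *)

Set Implicit Arguments.
Unset Strict Implicit.
Unset Printing Implicit Defensive.
Import Order.TTheory GRing.Theory Num.Theory.
Import numFieldNormedType.Exports.

Local Open Scope classical_set_scope.
Local Open Scope ring_scope.

(** * Bounded measurable functions and their integrals *)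

Definition bounded_measurable d (T : measurableType d) (R : realType)
    (f : T -> R) : Prop :=
  measurable_fun [set: T] f /\ exists C, forall x, `|f x| <= C.

Section bounded_measurable_theory.
Context {R : realType} d {T : measurableType d}.
Implicit Types f g : T -> R.

Lemma bounded_measurable_cst (r : R) :
  bounded_measurable (fun _ : T => r).
Proof. by split; [exact: measurable_cst|exists `|r|]. Qed.

Lemma bounded_measurableD f g : bounded_measurable f -> bounded_measurable g ->
  bounded_measurable (fun x => f x + g x).
Proof.
move=> [mf [C fC]] [mg [C' gC']]; split; first exact: measurable_funD.
by exists (C + C') => x; rewrite (le_trans (ler_normD _ _))// lerD.
Qed.

Lemma bounded_measurableB f g : bounded_measurable f -> bounded_measurable g ->
  bounded_measurable (fun x => f x - g x).
Proof.
move=> [mf [C fC]] [mg [C' gC']]; split; first exact: measurable_funB.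
by exists (C + C') => x; rewrite (le_trans (ler_normB _ _))// lerD.
Qed.

Lemma bounded_measurableZ (r : R) f : bounded_measurable f ->
  bounded_measurable (fun x => r * f x).
Proof.
move=> [mf [C fC]]; split; first exact: measurable_funM.
by exists (`|r| * C) => x; rewrite normrM ler_wpM2l.
Qed.

Lemma bounded_measurable_comp d' (S : measurableType d') (phi : S -> T) f :
  measurable_fun [set: S] phi -> bounded_measurable f ->
  bounded_measurable (fun s => f (phi s)).
Proof.
move=> mphi [mf [C fC]]; split; last by exists C => s; exact: fC.
exact: (measurableT_comp mf mphi).
Qed.

Lemma bounded_measurable_integrable (m : {measure set T -> \bar R}) f :
  (m [set: T] < +oo)%E -> bounded_measurable f ->
  m.-integrable [set: T] (EFin \o f).
Proof.
move=> moo [mf [C fC]]; apply: measurable_bounded_integrable => //.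
exists C; split; first exact: num_real.
by move=> c Cc x _; apply: le_trans (fC x) (ltW Cc).
Qed.

End bounded_measurable_theory.

Section mean.
Context {R : realType} d {T : measurableType d}
  (m : {measure set T -> \bar R}).
Hypothesis m1 : m [set: T] = 1%E.
Implicit Types f g : T -> R.

Let int f : bounded_measurable f -> m.-integrable [set: T] (EFin \o f).
Proof. by move=> bf; apply: bounded_measurable_integrable; rewrite ?m1 ?ltry. Qed.

Lemma EFin_mean f : bounded_measurable f ->
  (\int[m]_x f x)%:E = (\int[m]_x (f x)%:E)%E.
Proof. by move=> bf; rewrite fineK//; exact: integrable_fin_num (int bf). Qed.

Lemma mean_cst (r : R) : \int[m]_x r = r.
Proof. by rewrite Rintegral_cst// [X in fine X]m1/= mulr1. Qed.

Lemma meanD f g : bounded_measurable f -> bounded_measurable g ->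
  \int[m]_x (f x + g x) = \int[m]_x f x + \int[m]_x g x.
Proof. by move=> bf bg; rewrite RintegralD//; exact: int. Qed.

Lemma meanB f g : bounded_measurable f -> bounded_measurable g ->
  \int[m]_x (f x - g x) = \int[m]_x f x - \int[m]_x g x.
Proof. by move=> bf bg; rewrite RintegralB//; exact: int. Qed.

Lemma meanZ (r : R) f : bounded_measurable f ->
  \int[m]_x (r * f x) = r * \int[m]_x f x.
Proof. by move=> bf; rewrite RintegralZl//; exact: int. Qed.

Lemma mean_le f g : bounded_measurable f -> bounded_measurable g ->
  (forall x, f x <= g x) -> \int[m]_x f x <= \int[m]_x g x.
Proof. by move=> bf bg fg; apply: le_Rintegral => //; exact: int. Qed.

Lemma mean_le_cst f (r : R) : bounded_measurable f ->
  (forall x, f x <= r) -> \int[m]_x f x <= r.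
Proof.
move=> bf fr; rewrite -[leRHS]mean_cst.
by apply: mean_le => //; exact: bounded_measurable_cst.
Qed.

Lemma mean_ge_cst f (r : R) : bounded_measurable f ->
  (forall x, r <= f x) -> r <= \int[m]_x f x.
Proof.
move=> bf fr; rewrite -[leLHS]mean_cst.
by apply: mean_le => //; exact: bounded_measurable_cst.
Qed.

Lemma mean_dist_le f (a e : R) : bounded_measurable f ->
  (forall x, `|f x - a| <= e) -> `|\int[m]_x f x - a| <= e.
Proof.
move=> bf fae; rewrite ler_distl; apply/andP; split.
  by apply: mean_ge_cst => // x; have := fae x; rewrite ler_distl => /andP[].
by apply: mean_le_cst => // x; have := fae x; rewrite ler_distl => /andP[].
Qed.

End mean.

Lemma mean_dirac (R : realType) d (T : measurableType d) (a : T) (f : T -> R) :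
  measurable_fun [set: T] f -> \int[\d_a]_x f x = f a.
Proof.
move=> mf; rewrite /Rintegral integral_dirac//; last exact/measurable_EFinP.
by rewrite diracT mul1e.
Qed.

Lemma mean_pushforward (R : realType) d d' (S : measurableType d)
    (T : measurableType d') (m : {measure set S -> \bar R})
    (m1 : m [set: S] = 1%E) (l : {measure set T -> \bar R}) (phi : S -> T)
    (f : T -> R) :
  measurable_fun [set: S] phi ->
  (forall A, measurable A -> l A = m (phi @^-1` A)) ->
  bounded_measurable f -> \int[l]_x f x = \int[m]_s f (phi s).
Proof.
move=> mphi lm bf; have bfp := bounded_measurable_comp mphi bf.
rewrite /Rintegral (@eq_measure_integral _ _ _ _ (pushforward m phi))//; last first.
  by move=> A mA _; rewrite lm.
rewrite integral_pushforward//; first by apply/measurable_EFinP; case: bf.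
apply: (@bounded_measurable_integrable R _ _ m (f \o phi)) => //.
by rewrite m1 ltry.
Qed.

(** Adding a constant makes a bounded function nonnegative, which transfers the
    disintegration formula from nonnegative to bounded functions. *)
Lemma mean_mixture (R : realType) d d' (S : measurableType d)
    (T : measurableType d') (m : {measure set S -> \bar R})
    (m1 : m [set: S] = 1%E) (k : S -> {measure set T -> \bar R})
    (k1 : forall s, k s [set: T] = 1%E) (l : {measure set T -> \bar R})
    (l1 : l [set: T] = 1%E) (f : T -> R) :
  (forall g : T -> \bar R, (forall x, 0 <= g x)%E ->
    measurable_fun [set: T] g ->
    (\int[l]_x g x = \int[m]_s \int[k s]_x g x)%E) ->
  bounded_measurable f ->
  bounded_measurable (fun s => \int[k s]_x f x) ->
  \int[l]_x f x = \int[m]_s \int[k s]_x f x.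
Proof.
move=> mix bf bk; have [mf [C fC]] := bf.
have bC : bounded_measurable (fun _ : T => C) by exact: bounded_measurable_cst.
have bfC := bounded_measurableD bf bC.
apply: (@addIr _ C); rewrite -{1}(mean_cst l1 C) -meanD//.
rewrite -[X in _ = _ + X](mean_cst m1 C) -meanD//; last exact: bounded_measurable_cst.
apply: EFin_inj; rewrite EFin_mean// EFin_mean//; last first.
  exact: bounded_measurableD bk (bounded_measurable_cst _).
rewrite mix; last 2 first.
- by move=> x; rewrite lee_fin -lerBlDr sub0r; have := fC x; rewrite ler_norml => /andP[].
- by apply/measurable_EFinP; case: bfC.
apply: eq_integral => s _; rewrite -EFin_mean//; congr EFin.
by rewrite meanD// (mean_cst (k1 s)).
Qed.

Section kernel_means.
Context {R : realType}.

Lemma bounded_measurable_kernel d d' (S : measurableType d)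
    (T : measurableType d') (k : R.-pker S ~> T) (f : S * T -> R) :
  bounded_measurable f ->
  bounded_measurable (fun s => \int[k s]_x f (s, x)).
Proof.
move=> [mf [C fC]]; have k1 s : k s [set: T] = 1%E by exact: prob_kernel.
have bs s : bounded_measurable (fun x => f (s, x)).
  split; last by exists C => x; exact: fC.
  exact: measurableT_comp mf (pair1_measurable s).
split; last first.
  exists C => s; rewrite -[X in `|X|]subr0.
  by apply: mean_dist_le => // x; rewrite subr0.
pose g (z : S * T) := (f z + C)%:E.
have mg : measurable_fun [set: S * T] g.
  by apply/measurable_EFinP; exact: measurable_funD.
rewrite (_ : (fun s => _) =
    (fun s => fine (\int[k s]_x g (s, x))%E - C)); last first.
  apply/funext => s; apply: (@addIr _ C); rewrite subrK.
  rewrite -[X in _ + X = _](mean_cst (k1 s) C) -meanD//.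
  exact: bounded_measurable_cst.
apply: measurable_funB => //; apply: (measurableT_comp (fine_measurable measurableT)).
apply: (measurable_fun_integral_finite_kernel g k) => //.
by move=> z; rewrite lee_fin -lerBlDr sub0r; have := fC z; rewrite ler_norml => /andP[].
Qed.

Lemma mean_kseqcomp d0 d1 d2 (S : measurableType d0) (T : measurableType d1)
    (Z : measurableType d2) (k1 : R.-pker S ~> T) (k2 : R.-pker (S * T) ~> Z)
    s (f : Z -> R) :
  bounded_measurable f ->
  \int[kseqcomp k1 k2 s]_z f z = \int[k1 s]_t \int[k2 (s, t)]_z f z.
Proof.
move=> bf.
apply: (@mean_mixture R _ _ _ _ (k1 s) _ (fun t => k2 (s, t))) => //.
- exact: prob_kernel.
- by move=> t; exact: prob_kernel.
- exact: prob_kernel.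
- by move=> g g0 mg; exact: integral_kcomp.
- apply: (@bounded_measurable_comp _ _ _ _ _ (pair s)
     (fun st => \int[k2 st]_z f z)); first exact: pair1_measurable.
  apply: (@bounded_measurable_kernel _ _ _ _ k2 (f \o snd)).
  exact: bounded_measurable_comp.
Qed.

End kernel_means.

Section kprod_means.
Context {R : realType} d0 d1 d2 (S : measurableType d0) (T : measurableType d1)
  (Z : measurableType d2) (k1 : R.-pker S ~> T) (k2 : R.-pker (S * T) ~> Z).

(* The kernel product is the composition of k1 with the kernel that moves the
   measure k2 (s, t) to the graph {t} x Z. *)
Let graph : R.-pker (S * T) ~> (T * Z)%type :=
  kprod (kdirac measurable_snd) (kpullback k2 measurable_fst).

Let graphE st A : measurable A -> graph st A = k2 st (pair st.2 @^-1` A).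
Proof.
move=> mA.
transitivity (\int[\d_(st.2)]_y (\int[k2 st]_z (\1_A (y, z))%:E))%E; first by [].
rewrite integral_dirac//; last first.
  apply: (measurable_fun_integral_finite_kernel
    (fun yz => (\1_A yz)%:E) (kpullback k2 (measurable_cst st))) => //.
  exact/measurable_EFinP/measurable_indic.
have mA2 : measurable (pair st.2 @^-1` A).
  by rewrite -[X in measurable X]setTI; exact: pair1_measurable.
rewrite diracT mul1e.
transitivity (\int[k2 st]_z (\1_(pair st.2 @^-1` A) z)%:E)%E; first by [].
by rewrite integral_indic// setIT.
Qed.

Lemma mean_kprod s (f : T * Z -> R) : bounded_measurable f ->
  \int[kprod k1 k2 s]_tz f tz = \int[k1 s]_t \int[k2 (s, t)]_z f (t, z).
Proof.
move=> bf.
transitivity (\int[kseqcomp k1 graph s]_tz f tz).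
  congr fine; apply: eq_measure_integral => A mA _.
  apply: eq_integral => t _.
  have mtA : measurable (pair t @^-1` A).
    by rewrite -[X in measurable X]setTI; exact: pair1_measurable.
  rewrite [RHS]graphE//.
  transitivity (\int[k2 (s, t)]_z (\1_(pair t @^-1` A) z)%:E)%E; first by [].
  by rewrite integral_indic// setIT.
rewrite mean_kseqcomp//; apply: eq_Rintegral => t _.
apply: mean_pushforward => //; first exact: prob_kernel.
by move=> A mA; rewrite graphE.
Qed.

End kprod_means.

(** * Verification: approximate optimality inequalities bound average costs *)

(** The function h is a relative value function in the average cost equation,
    and b times a value function in the equation with discount factor b. *)
Definition qval (R : realType) dX dU (X : borelMetricType R dX)
    (U : measurableType dU) (M : mdp X U) (h : X -> R) (xu : X * U) : R :=
  cost M xu + \int[trans M xu]_y h y.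

Section verification.
Context {R : realType} {dX dU : measure_display}
  {X : borelMetricType R dX} {U : measurableType dU}.
Variable M : mdp X U.
Hypothesis bounded_cost : bounded_measurable (cost M).
Implicit Types (h : X -> R) (p : policy X U).

Lemma bounded_measurable_next h : bounded_measurable h ->
  bounded_measurable (fun xu => \int[trans M xu]_y h y).
Proof.
move=> bh; apply: (@bounded_measurable_kernel _ _ _ _ _ (trans M) (h \o snd)).
exact: bounded_measurable_comp.
Qed.

Lemma bounded_measurable_qval h : bounded_measurable h ->
  bounded_measurable (qval M h).
Proof.
by move=> bh; apply: bounded_measurableD => //; exact: bounded_measurable_next.
Qed.

Lemma bounded_measurable_total_cost t :
  bounded_measurable (@total_cost _ _ _ X U M t).
Proof.
elim: t => [|t IH] /=; first exact: bounded_measurable_cst.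
apply: bounded_measurableD.
  apply: (bounded_measurable_comp (phi := fun k : hist X U t * U * X => k.1.1)) => //.
  exact: measurableT_comp measurable_fst measurable_fst.
apply: (bounded_measurable_comp
  (phi := fun k : hist X U t * U * X => (last_state k.1.1, k.1.2))) => //.
apply/measurable_fun_pairP; split.
  apply: (measurableT_comp (@measurable_last_state _ _ X U t)).
  exact: measurableT_comp measurable_fst measurable_fst.
exact: measurableT_comp measurable_snd measurable_fst.
Qed.

Lemma mean_hist_lawS p t x (f : hist X U t.+1 -> R) : bounded_measurable f ->
  \int[hist_law M p t.+1 x]_k f k =
  \int[hist_law M p t x]_k \int[p t k]_u
    \int[trans M (last_state k, u)]_y f (k, u, y).
Proof.
move=> bf; rewrite [LHS]mean_kprod// [LHS]mean_kprod//.
pose f' (z : X * (hist X U t * U) * X) := f (z.1.2, z.2).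
have mf' : bounded_measurable f'.
  apply: (bounded_measurable_comp
    (phi := fun z : X * (hist X U t * U) * X => (z.1.2, z.2)) _ bf).
  apply/measurable_fun_pairP; split; last exact: measurable_snd.
  exact: measurableT_comp measurable_snd measurable_fst.
have := bounded_measurable_kernel
  (kpullback (trans M) (@measurable_last_state_action _ _ X U t)) mf'.
move=> /(bounded_measurable_comp (phi := pair x)); apply.
exact: pair1_measurable.
Qed.

Section drift.
Variables (p : policy X U) (h : X -> R).
Hypothesis bh : bounded_measurable h.

Let potential t (k : hist X U t) := total_cost M k + h (last_state k).

(** The conditional expectation, given the history, of the increment of the
    total cost plus h of the current state.  The policy and the costs enter the
    bounds on average costs only through it. *)
Definition drift t (k : hist X U t) : R :=
  \int[p t k]_u qval M h (last_state k, u) - h (last_state k).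

Let bounded_potential t : bounded_measurable (@potential t).
Proof.
apply: bounded_measurableD; first exact: bounded_measurable_total_cost.
apply: bounded_measurable_comp bh; exact: measurable_last_state.
Qed.

Let bounded_policy_qval t :
  bounded_measurable (fun k : hist X U t => \int[p t k]_u qval M h (last_state k, u)).
Proof.
apply: (bounded_measurable_kernel (p t)
  (f := fun ku => qval M h (last_state ku.1, ku.2))).
apply: (bounded_measurable_comp
  (phi := fun ku : hist X U t * U => (last_state ku.1, ku.2)) _
  (bounded_measurable_qval bh)).
apply/measurable_fun_pairP; split; last exact: measurable_snd.
exact: measurableT_comp (@measurable_last_state _ _ X U t) measurable_fst.
Qed.

Let bounded_drift t : bounded_measurable (@drift t).
Proof.
apply: bounded_measurableB => //.
apply: bounded_measurable_comp bh; exact: measurable_last_state.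
Qed.

Let mean_potentialS t x :
  \int[hist_law M p t.+1 x]_k potential k =
  \int[hist_law M p t x]_k potential k + \int[hist_law M p t x]_k drift k.
Proof.
rewrite mean_hist_lawS// -meanD//; last exact: prob_kernel.
apply: eq_Rintegral => k _; rewrite /potential/= /drift.
have bq : bounded_measurable (fun u => qval M h (last_state k, u)).
  apply: (bounded_measurable_comp (phi := pair (last_state k))).
    exact: pair1_measurable.
  exact: bounded_measurable_qval.
transitivity (\int[p t k]_u (total_cost M k + qval M h (last_state k, u))).
  apply: eq_Rintegral => u _.
  have k1 : trans M (last_state k, u) [set: X] = 1%E by exact: prob_kernel.
  rewrite /qval addrA -[X in _ = X + _](mean_cst k1) -meanD//.
  exact: bounded_measurable_cst.
have k1 : p t k [set: U] = 1%E by exact: prob_kernel.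
rewrite meanD//; last exact: bounded_measurable_cst.
by rewrite (mean_cst k1); ring.
Qed.

Let mean_potential0 x : \int[hist_law M p 0 x]_k potential k = h x.
Proof.
rewrite [LHS](mean_dirac x (f := fun y => 0 + h y)) ?add0r//.
by apply: measurable_funD => //; case: bh.
Qed.

(** The drifts telescope; the boundary terms h(X_0) and h(X_t) cost 2 C. *)
Lemma mean_total_cost_ge r C x t : (forall y, `|h y| <= C) ->
  (forall t (k : hist X U t), r <= drift k) ->
  t%:R * r - 2 * C <= \int[hist_law M p t x]_k total_cost M k.
Proof.
move=> hC rd.
have gr : t%:R * r + h x <= \int[hist_law M p t x]_k potential k.
  elim: t => [|t IH]; first by rewrite mul0r add0r mean_potential0.
  rewrite mean_potentialS -natr1 mulrDl mul1r addrAC lerD//.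
  apply: mean_ge_cst => //; exact: prob_kernel.
have : \int[hist_law M p t x]_k potential k <=
    \int[hist_law M p t x]_k total_cost M k + C.
  have k1 : hist_law M p t x setT = 1%E by exact: prob_kernel.
  rewrite -[X in _ + X](mean_cst k1).
  rewrite -meanD//; [|exact: bounded_measurable_total_cost
    |exact: bounded_measurable_cst].
  apply: mean_le => //.
    apply: bounded_measurableD; first exact: bounded_measurable_total_cost.
    exact: bounded_measurable_cst.
  by move=> k; rewrite /potential lerD2l (le_trans (ler_norm _)).
have := hC x; rewrite ler_norml => /andP[? ?].
by move: gr; lra.
Qed.

Lemma mean_total_cost_le r C x t : (forall y, `|h y| <= C) ->
  (forall t (k : hist X U t), drift k <= r) ->
  \int[hist_law M p t x]_k total_cost M k <= t%:R * r + 2 * C.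
Proof.
move=> hC rd.
have gr : \int[hist_law M p t x]_k potential k <= t%:R * r + h x.
  elim: t => [|t IH]; first by rewrite mul0r add0r mean_potential0.
  rewrite mean_potentialS -natr1 mulrDl mul1r addrAC lerD//.
  apply: mean_le_cst => //; exact: prob_kernel.
have : \int[hist_law M p t x]_k total_cost M k - C <=
    \int[hist_law M p t x]_k potential k.
  have k1 : hist_law M p t x setT = 1%E by exact: prob_kernel.
  rewrite -[X in _ - X](mean_cst k1).
  rewrite -meanB//; [|exact: bounded_measurable_total_cost
    |exact: bounded_measurable_cst].
  apply: mean_le => //.
    apply: bounded_measurableB; first exact: bounded_measurable_total_cost.
    exact: bounded_measurable_cst.
  by move=> k; rewrite /potential lerD2l lerNl (le_trans (ler_norm _))// normrN.
have := hC x; rewrite ler_norml => /andP[? ?].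
by move: gr; lra.
Qed.

Lemma avg_cost_ge r x : (forall t (k : hist X U t), r <= drift k) ->
  (r%:E <= avg_cost M x p)%E.
Proof.
move=> rd; have [_ [C hC]] := bh.
rewrite /avg_cost limn_esup_lim; apply: lime_ge; first exact: is_cvg_esups.
apply: nearW => n; apply/lee_addgt0Pr => e e0.
(* A time beyond n at which the boundary terms weigh at most e. *)
pose N := (maxn n (Num.truncn (2 * C / e)).+1).+1.
have N0 : (0 : R) < N%:R by rewrite ltr0n.
have CN : 2 * C / N%:R <= e.
  rewrite ler_pdivrMr// (mulrC e) -ler_pdivrMr//.
  apply: (le_trans (ltW (truncnS_gt _))).
  by rewrite ler_nat (leq_trans (leq_maxr n _)).
apply: (@le_trans _ _ ((N%:R^-1)%:E *
    \int[hist_law M p N x]_k (total_cost M k)%:E + e%:E)%E); last first.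
  rewrite leeD2r//; apply: ereal_sup_ubound; exists N => //=.
  by rewrite (leq_trans (leq_maxl n (Num.truncn (2 * C / e)).+1)).
rewrite -EFin_mean; [|exact: prob_kernel|exact: bounded_measurable_total_cost].
rewrite -EFinM -EFinD lee_fin.
have Ni0 : (0 : R) <= N%:R^-1 by rewrite invr_ge0.
have := ler_wpM2l Ni0 (mean_total_cost_ge x N hC rd).
rewrite mulrBr mulKf ?gt_eqF//.
by move: CN; rewrite (mulrC (2 * C)); lra.
Qed.

Lemma avg_cost_le r x : (forall t (k : hist X U t), drift k <= r) ->
  (avg_cost M x p <= r%:E)%E.
Proof.
move=> rd; have [_ [C hC]] := bh.
rewrite /avg_cost limn_esup_lim; apply/lee_addgt0Pr => e e0.
pose n := (Num.truncn (2 * C / e)).+1.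
have ne (m : nat) : (n <= m)%N -> 2 * C / m%:R <= e.
  move=> nm; have m0 : (0 : R) < m%:R by rewrite ltr0n (leq_trans _ nm).
  rewrite ler_pdivrMr// (mulrC e) -ler_pdivrMr//.
  apply: (le_trans (ltW (truncnS_gt _))).
  by rewrite ler_nat.
apply: lime_le; first exact: is_cvg_esups.
exists n => // m /= nm; apply: ge_ereal_sup => _ /= [N mN <-].
have nN := leq_trans nm mN.
have N0 : (0 : R) < N%:R by rewrite ltr0n (leq_trans _ nN).
rewrite -EFin_mean; [|exact: prob_kernel|exact: bounded_measurable_total_cost].
rewrite -EFinM lee_fin.
have Ni0 : (0 : R) <= N%:R^-1 by rewrite invr_ge0.
have := ler_wpM2l Ni0 (mean_total_cost_le x N hC rd).
rewrite mulrDr mulKf ?gt_eqF//.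
by have := ne _ nN; rewrite (mulrC (2 * C)); lra.
Qed.

End drift.

Lemma drift_stationary (f : {mfun X >-> U}) h t (k : hist X U t) :
  bounded_measurable h ->
  drift (stationary f) h k =
  qval M h (last_state k, f (last_state k)) - h (last_state k).
Proof.
move=> bh; congr (_ - _).
apply: (@mean_dirac _ _ _ _ (fun u => qval M h (last_state k, u))).
have [mq _] := bounded_measurable_qval bh.
exact: measurableT_comp mq (pair1_measurable _).
Qed.

(** A policy draws its action from a probability measure, so averaging a bound
    valid for every action bounds the drift of every policy from below. *)
Lemma opt_cost_ge h r x : bounded_measurable h ->
  (forall x u, r + h x <= qval M h (x, u)) -> (r%:E <= opt_cost M x)%E.
Proof.
move=> bh rq; apply: le_ereal_inf_tmp => _ [p _ <-]; apply: (avg_cost_ge bh) => t k.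
rewrite /drift lerBrDr; apply: mean_ge_cst => //; first exact: prob_kernel.
apply: (bounded_measurable_comp (phi := pair (last_state k))).
  exact: pair1_measurable.
exact: bounded_measurable_qval.
Qed.

Lemma avg_cost_stationary_le (f : {mfun X >-> U}) h r x : bounded_measurable h ->
  (forall x, qval M h (x, f x) <= r + h x) ->
  (avg_cost M x (stationary f) <= r%:E)%E.
Proof.
move=> bh qr; apply: (avg_cost_le bh) => t k.
by rewrite drift_stationary// lerBlDr.
Qed.

Lemma avg_cost_stationary_ge (f : {mfun X >-> U}) h r x : bounded_measurable h ->
  (forall x, r + h x <= qval M h (x, f x)) ->
  (r%:E <= avg_cost M x (stationary f))%E.
Proof.
move=> bh qr; apply: (avg_cost_ge bh) => t k.
by rewrite drift_stationary// lerBrDr.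
Qed.

Lemma opt_cost_le (p : policy X U) x : (opt_cost M x <= avg_cost M x p)%E.
Proof. by apply: ereal_inf_lbound; exists p. Qed.

End verification.

(** * Approximate solutions of the average cost optimality equation *)

Section approximate_solutions.
Context {R : realType} {dX dU : measure_display}
  {X : borelMetricType R dX} {U : measurableType dU}.
Hypothesis finiteU : finite_set [set: U].

(** Running through the finitely many actions, the current best one is replaced
    on the measurable set where the next action is at least as good. *)
Lemma measurable_selector (g : X * U -> R) : measurable_fun [set: X * U] g ->
  exists f : {mfun X >-> U}, forall x u, g (x, f x) <= g (x, u).
Proof.
move=> mg; have /finite_seqP[s sE] := finiteU.
suff [f [mf fP]] : exists f : X -> U, measurable_fun [set: X] f /\
    forall x u, u \in s -> g (x, f x) <= g (x, u).
  exists (mfun_Sub (mem_set mf)) => x u; apply: fP.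
  by have : [set: U] u by []; rewrite sE.
elim: s {sE} => [|v s [f [mf fP]]]; first by exists (fun=> point); split.
exists (fun x => if g (x, v) <= g (x, f x) then v else f x); split.
  apply: measurable_fun_ifT => //; apply: measurable_fun_ler.
    exact: measurableT_comp mg (pair2_measurable v).
  apply: measurableT_comp mg _.
  by apply/measurable_fun_pairP; split => //; exact: measurable_id.
move=> x u; rewrite in_cons => /predU1P[->|us].
  by case: ifPn => //; rewrite -ltNge => /ltW.
have := fP x u us.
by case: ifPn => // gvf; apply: le_trans.
Qed.

Section one_model.
Variable M : mdp X U.
Hypothesis bounded_cost : bounded_measurable (cost M).

Definition approx_ACOE (e r : R) (h : X -> R) (f : X -> U) : Prop :=
  (forall x u, r + h x - e <= qval M h (x, u)) /\
  (forall x, qval M h (x, f x) <= r + h x + e).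

(** Dynamic programming with discount factor b, as a relation between v and its
    image w that keeps track of a minimizing policy f. *)
Definition discounted_update (b : R) (f : X -> U) (v w : X -> R) : Prop :=
  (forall x u, w x <= qval M (fun y => b * v y) (x, u)) /\
  (forall x, w x = qval M (fun y => b * v y) (x, f x)).

Lemma qvalD h g xu : bounded_measurable h -> bounded_measurable g ->
  qval M (fun x => h x + g x) xu = qval M h xu + \int[trans M xu]_x g x.
Proof.
move=> bh bg; rewrite /qval meanD ?addrA//; exact: prob_kernel.
Qed.

Lemma discounted_update_contract b f f' v w w' c :
  0 <= b -> bounded_measurable v -> bounded_measurable w ->
  discounted_update b f v w -> discounted_update b f' w w' ->
  (forall x, `|w x - v x| <= c) -> forall x, `|w' x - w x| <= b * c.
Proof.
move=> b0 bv bw [wmin wE] [w'min w'E] wvc x.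
have step u : `|qval M (fun y => b * w y) (x, u) -
                qval M (fun y => b * v y) (x, u)| <= b * c.
  have T1 : trans M (x, u) [set: X] = 1%E by exact: prob_kernel.
  rewrite /qval opprD addrACA subrr add0r !meanZ// -mulrBr -meanB//.
  rewrite normrM (ger0_norm b0) ler_wpM2l// -[X in `|X|]subr0.
  by apply: mean_dist_le => //; [exact: bounded_measurableB|move=> y; rewrite subr0].
have := step (f x); have := step (f' x).
rewrite -wE -w'E !ler_distl => /andP[l _] /andP[_ m]; apply/andP; split.
  by have := wmin x (f' x); lra.
by have := w'min x (f x); lra.
Qed.

(** Vanishing discount without a limit: when the discounted value iterates
    started at 0 have uniformly bounded span, an iterate v that is almost a
    fixed point for a discount factor b close to 1 almost solves the average
    cost optimality equation with constant (1 - b) v(z).  P records whatever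
    regularity the iterates preserve. *)
Lemma exists_approx_ACOE (P : (X -> R) -> Prop) (S : R) :
  (forall h, P h -> bounded_measurable h) ->
  (forall h x y, P h -> h x - h y <= S) ->
  P (fun=> 0) ->
  (forall b f v w, 0 <= b <= 1 -> P v -> measurable_fun [set: X] w ->
    discounted_update b f v w -> P w) ->
  forall e : R, 0 < e ->
  exists r h (f : {mfun X >-> U}), P h /\ approx_ACOE e r h f.
Proof.
move=> Pb PS P0 Pstep e e0; have [_ [C cC]] := bounded_cost.
have S0 : 0 <= S by have := PS _ point point P0; rewrite subrr.
have C0 : 0 <= C by apply: le_trans (cC point).
have e20 : 0 < e / 2 by rewrite divr_gt0.
have Se0 : 0 < S + e / 2 by rewrite ltr_wpDl.
(* The discount factor b is so close to 1 that (1 - b) S <= e / 2, and n is so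
   large that consecutive iterates differ by at most e / 2. *)
pose t := (e / 2) / (S + e / 2); pose b := 1 - t.
have t0 : 0 < t by rewrite divr_gt0.
have t1 : t <= 1 by rewrite ler_pdivrMr// mul1r lerDr.
have tS : t * S <= e / 2.
  by rewrite /t mulrAC ler_pdivrMr// ler_pM2l// lerDl ltW.
have b01 : 0 <= b <= 1 by rewrite /b; lra.
have b0 : 0 <= b by case/andP : b01.
have update v : P v -> exists (f : {mfun X >-> U}) w,
    P w /\ discounted_update b f v w.
  move=> Pv; have bq : bounded_measurable (qval M (fun y => b * v y)).
    by apply: bounded_measurable_qval => //; apply: bounded_measurableZ; exact: Pb.
  have [f fP] := measurable_selector bq.1.
  exists f, (fun x => qval M (fun y => b * v y) (x, f x)).
  suff vw : discounted_update b f v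
      (fun x => qval M (fun y => b * v y) (x, f x)).
    split => //; apply: Pstep vw => //; apply: measurableT_comp bq.1 _.
    apply/measurable_fun_pairP; split; first exact: measurable_id.
    exact: measurable_funPT.
  by split.
have iterate n : exists (f : {mfun X >-> U}) v w, [/\ P v, P w,
    discounted_update b f v w & forall x, `|w x - v x| <= b ^+ n * C].
  elim: n => [|n [f [v [w [Pv Pw vw wv]]]]].
    have [f [w [Pw vw]]] := update _ P0; exists f, (fun=> 0), w; split => // x.
    rewrite subr0 expr0 mul1r vw.2 /qval.
    rewrite (_ : (fun y => b * 0) = fun=> 0); last by apply/funext => y; rewrite mulr0.
    have T1 : trans M (x, f x) [set: X] = 1%E by exact: prob_kernel.
    by rewrite (mean_cst T1) addr0.
  have [f' [w' [Pw' ww']]] := update _ Pw; exists f', w, w'; split => // x.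
  rewrite exprS -mulrA.
  exact: (discounted_update_contract b0 (Pb _ Pv) (Pb _ Pw) vw ww' wv).
have [n bnC] : exists n, b ^+ n * C <= e / 2.
  have /cvgrPdist_le /(_ (e / 2 / (C + 1))) : (b ^+ n @[n --> \oo] --> (0 : R)).
    by apply: cvg_expr; rewrite ger0_norm// /b; lra.
  have C1 : 0 < C + 1 by rewrite ltr_wpDl.
  rewrite divr_gt0// => /(_ isT)[n _ /(_ n (leqnn n))].
  rewrite sub0r normrN ger0_norm ?exprn_ge0// ler_pdivlMr// => bn; exists n.
  by apply: le_trans bn; rewrite ler_wpM2l ?exprn_ge0// lerDl.
have [f [v [w [Pv Pw [wmin wE] wv]]]] := iterate n.
(* Undiscounting v costs (1 - b) v, which is (1 - b) v(point) up to
   (1 - b) S. *)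
have near x u : `|qval M v (x, u) - qval M (fun y => b * v y) (x, u)
    - (1 - b) * v point| <= e / 2.
  have T1 : trans M (x, u) [set: X] = 1%E by exact: prob_kernel.
  have bv := Pb _ Pv.
  rewrite (_ : _ - _ - _ = t * (\int[trans M (x, u)]_y v y - v point)); last first.
    by rewrite /qval meanZ// /b; ring.
  rewrite normrM (gtr0_norm t0); apply: le_trans tS; rewrite ler_wpM2l ?(ltW t0)//.
  apply: mean_dist_le => // y; rewrite ler_norml; apply/andP; split.
    by rewrite lerNl opprB; exact: PS.
  exact: PS.
exists ((1 - b) * v point), v, f; split => //; split=> [x u|x].
  have := near x u; have := wv x; have := wmin x u.
  by rewrite !ler_norml => ? /andP[? ?] /andP[? ?]; lra.
have := near x (f x); have := wv x.
by rewrite -wE !ler_norml => /andP[? ?] /andP[? ?]; lra.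
Qed.

Lemma approx_ACOE_opt_cost e r h (f : {mfun X >-> U}) x : bounded_measurable h ->
  approx_ACOE e r h f ->
  ((r - e)%R%:E <= opt_cost M x)%E /\ (opt_cost M x <= (r + e)%R%:E)%E.
Proof.
move=> bh [lo up]; split.
  by apply: (opt_cost_ge bounded_cost _ bh) => y u; have := lo y u; lra.
apply: le_trans (opt_cost_le _ (stationary f) _) _.
by apply: (avg_cost_stationary_le bounded_cost _ bh) => y; have := up y; lra.
Qed.

End one_model.

End approximate_solutions.

(** Two values of the function differ by at most 2 e for every e > 0. *)
Lemma constant_of_approx (R : realType) (T : pointedType) (a : T -> \bar R) :
  (forall e : R, 0 < e -> exists r, forall x,
    ((r - e)%R%:E <= a x)%E /\ (a x <= (r + e)%R%:E)%E) ->
  exists rho, forall x, a x = rho%:E.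
Proof.
move=> ar; have fin x : a x \is a fin_num.
  have [r /(_ x)[l u]] := ar 1 ltr01.
  rewrite fin_numE; apply/andP; split; apply/eqP => ax.
    by move: l; rewrite ax leeNy_eq.
  by move: u; rewrite ax leye_eq.
exists (fine (a point)) => x; rewrite -(fineK (fin x)); congr EFin.
apply/eqP; rewrite -subr_eq0 -normr_le0; apply/ler_addgt0Pr => e e0.
have e20 : 0 < e / 2 by rewrite divr_gt0.
have [r rP] := ar _ e20.
have := rP x; have := rP point.
rewrite -(fineK (fin x)) -(fineK (fin point)) !lee_fin add0r.
move: (fine (a x)) (fine (a point)) => ax ap [? ?] [? ?].
by rewrite ler_norml /=; apply/andP; split; lra.
Qed.

(** * Minorization *)

(** Only the masses 1 - nu(X) outside the common part nu can see different
    values of h.  Subtracting nu is avoided: with a = inf h, the integral of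
    h - a against m2 and that of s - (h - a) against m1 are at least those
    against nu. *)
Lemma mean_gap (R : realType) d (T : measurableType d)
    (nu m1 m2 : {measure set T -> \bar R}) (h : T -> R) (s : R) :
  m1 [set: T] = 1%E -> m2 [set: T] = 1%E ->
  (forall A, measurable A -> (nu A <= m1 A)%E) ->
  (forall A, measurable A -> (nu A <= m2 A)%E) ->
  bounded_measurable h -> (forall x y, h x - h y <= s) ->
  \int[m1]_x h x - \int[m2]_x h x <= (1 - fine (nu [set: T])) * s.
Proof.
move=> m11 m21 nu1 nu2 bh hs; have [mh [C hC]] := bh.
have hasinf : has_inf (range h).
  split; first by exists (h point), point.
  by exists (- C) => _ [x _ <-]; have := hC x; rewrite ler_norml => /andP[].
pose a := inf (range h).
have ha x : a <= h x by apply: ge_inf; [case: hasinf|exists x].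
have hb x : h x <= a + s.
  rewrite -lerBlDr; apply: lb_le_inf; first by case: hasinf.
  by move=> _ [y _ <-]; have := hs x y; lra.
have nuoo : (nu [set: T] < +oo)%E by rewrite (le_lt_trans (nu1 _ measurableT))// m11 ltry.
have below (m : {measure set T -> \bar R}) (g : T -> R) : m [set: T] = 1%E ->
    (forall A, measurable A -> (nu A <= m A)%E) ->
    bounded_measurable g -> (forall x, 0 <= g x) ->
    \int[nu]_x g x <= \int[m]_x g x.
  move=> m_1 num bg g0; apply: fine_le.
  - exact: integrable_fin_num (bounded_measurable_integrable nuoo bg).
  - apply: integrable_fin_num (bounded_measurable_integrable _ bg) => //.
    by rewrite m_1 ltry.
  - apply: ge0_le_measure_integral => //.
    by apply/measurable_EFinP; case: bg.
have ba : bounded_measurable (fun _ : T => a) by exact: bounded_measurable_cst.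
have bs : bounded_measurable (fun _ : T => s) by exact: bounded_measurable_cst.
have bg := bounded_measurableB bh ba.
have low : \int[nu]_x (h x - a) <= \int[m2]_x (h x - a).
  by apply: below => // x; rewrite subr_ge0.
have up : \int[nu]_x (s - (h x - a)) <= \int[m1]_x (s - (h x - a)).
  apply: below => //; first exact: bounded_measurableB.
  by move=> x; rewrite subr_ge0 lerBlDl.
have nusg : \int[nu]_x (s - (h x - a)) =
    s * fine (nu [set: T]) - \int[nu]_x (h x - a).
  by rewrite RintegralB ?Rintegral_cst//; exact: bounded_measurable_integrable.
move: low up; rewrite nusg (meanB m11)// (mean_cst m11) (meanB m11)// (mean_cst m11).
rewrite (meanB m21)// (mean_cst m21).
by lra.
Qed.

Section minorized_models.
Context {R : realType} {dX dU : measure_display}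
  {X : borelMetricType R dX} {U : measurableType dU}.
Implicit Types (M : mdp X U) (nu : {measure set X -> \bar R}).

Definition minorized M nu : Prop :=
  forall xu B, measurable B -> (nu B <= trans M xu B)%E.

Lemma minorized_gap M nu h s xu xu' : minorized M nu ->
  bounded_measurable h -> (forall x y, h x - h y <= s) ->
  \int[trans M xu]_x h x - \int[trans M xu']_x h x <=
  (1 - fine (nu [set: X])) * s.
Proof.
move=> nuM bh hs; apply: mean_gap => //; try exact: prob_kernel.
all: by move=> A mA; exact: nuM.
Qed.

Lemma minorized_mass_le1 M nu : minorized M nu -> 0 <= 1 - fine (nu [set: X]).
Proof.
move=> nuM; have := nuM point _ measurableT; rewrite subr_ge0.
have -> : trans M point [set: X] = 1%E by exact: prob_kernel.
move=> nu1; apply: (@fine_le _ (nu [set: X]) 1%E) => //.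
by rewrite ge0_fin_numE// (le_lt_trans nu1)// ltry.
Qed.

(** The model in which f overrides the chosen action, so that its optimal
    values are the values of the policy f. *)
Section override.
Variables (M : mdp X U) (f : {mfun X >-> U}).

Let mf : measurable_fun [set: X * U] (fun xu : X * U => (xu.1, f xu.1)).
Proof.
apply/measurable_fun_pairP; split; first exact: measurable_fst.
exact: measurableT_comp (measurable_funPT _) measurable_fst.
Qed.

Definition override : mdp X U :=
  MDP (kpullback (trans M) mf) (measurableT_comp (measurable_cost M) mf).

Lemma bounded_override : bounded_measurable (cost M) ->
  bounded_measurable (cost override).
Proof. exact: bounded_measurable_comp. Qed.

Lemma qval_override h x u : qval override h (x, u) = qval M h (x, f x).
Proof. by []. Qed.

Lemma minorized_override nu : minorized M nu -> minorized override nu.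
Proof. by move=> nuM xu B mB; exact: nuM. Qed.

End override.

Hypothesis finiteU : finite_set [set: U].

(** Under minorization every discounted iterate has span at most
    S = 2 C / nu(X), the fixed point of S = 2 C + k S for C a bound of the
    cost.  P is any further property of the iterates. *)
Lemma minorized_approx_ACOE M nu (P : (X -> R) -> Prop) :
  bounded_measurable (cost M) -> minorized M nu -> 0 < fine (nu [set: X]) ->
  P (fun=> 0) ->
  (forall b f v w, 0 <= b <= 1 -> bounded_measurable v -> P v ->
    bounded_measurable w -> discounted_update M b f v w -> P w) ->
  forall e : R, 0 < e -> exists r h (f : {mfun X >-> U}),
    [/\ bounded_measurable h, P h & approx_ACOE M e r h f].
Proof.
move=> bc nuM nu0 P0 Pstep e e0; have [_ [C cC]] := bc.
have k0 := minorized_mass_le1 nuM; set k := 1 - _ in k0.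
have k1 : k < 1 by rewrite /k; lra.
have C0 : 0 <= C by apply: le_trans (cC point).
pose S := 2 * C / (1 - k).
have SE : 2 * C + k * S = S by rewrite /S; field; lra.
have S0 : 0 <= S by rewrite divr_ge0// ?mulr_ge0//; lra.
pose P' (h : X -> R) :=
  [/\ bounded_measurable h, P h & forall x y, h x - h y <= S].
have [||||r [h [f [[bh Ph _] hf]]]] :=
    @exists_approx_ACOE _ _ _ _ _ finiteU M bc P' S _ _ _ _ e e0.
- by move=> h [].
- by move=> h x y [].
- by split => //; [exact: bounded_measurable_cst|move=> x y; rewrite subrr].
- move=> b f v w b01 [bv Pv vS] mw vw; have /andP[b0 b1] := b01.
  have bbv := bounded_measurableZ b bv; have [wmin wE] := vw.
  have bw : bounded_measurable w.
    split => //; have [_ [D qD]] := bounded_measurable_qval bc bbv.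
    by exists D => x; rewrite wE.
  split => //; first exact: Pstep vw.
  move=> x y; have := wmin x (f y); rewrite (wE y) /qval.
  have T1 xu : trans M xu [set: X] = 1%E by exact: prob_kernel.
  rewrite !meanZ//.
  have := minorized_gap (x, f y) (y, f y) nuM bv vS; rewrite -/k.
  move/(ler_wpM2l b0).
  have : b * (k * S) <= k * S by rewrite ler_piMl// mulr_ge0.
  have := cC (x, f y); have := cC (y, f y); rewrite !ler_norml.
  by move=> /andP[? ?] /andP[? ?]; lra.
by exists r, h, f; split.
Qed.

Lemma minorized_opt_cost M nu : bounded_measurable (cost M) ->
  minorized M nu -> 0 < fine (nu [set: X]) ->
  exists rho, forall x, opt_cost M x = rho%:E.
Proof.
move=> bc nuM nu0; apply: constant_of_approx => e e0.
have [//|//|r [h [f [bh _ hf]]]] :=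
  @minorized_approx_ACOE M nu (fun=> True) bc nuM nu0 _ _ e e0.
exists r => x.
exact: (approx_ACOE_opt_cost bc x bh hf).
Qed.

Lemma minorized_avg_cost M nu (f : {mfun X >-> U}) :
  bounded_measurable (cost M) -> minorized M nu -> 0 < fine (nu [set: X]) ->
  exists rho, forall x, avg_cost M x (stationary f) = rho%:E.
Proof.
move=> bc nuM nu0; apply: constant_of_approx => e e0.
have [//|//|r [h [g [bh _ [lo up]]]]] := @minorized_approx_ACOE (override M f) nu
  (fun=> True) (bounded_override f bc) (minorized_override f nuM) nu0 _ _ e e0.
exists r => x; split.
  apply: (avg_cost_stationary_ge bc _ bh) => y.
  by have := lo y point; rewrite qval_override; lra.
apply: (avg_cost_stationary_le bc _ bh) => y.
by have := up y; rewrite qval_override; lra.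
Qed.

(** Let h almost solve the optimality equation of M and the one-step values of
    h in M and M' differ by at most e.  As M' contracts spans, its exact
    relative value function h' satisfies span(h' - h) <= 2 (e + eps) / (1 - k).
    Comparing the action of f, which is optimal for h' in M', with an action
    that is optimal for h costs e twice for the exchange of M and M', and only
    k span(h' - h) for the exchange of h and h' under the integral. *)
Lemma avg_cost_transfer M M' nu (f : {mfun X >-> U}) (e eps r : R) h
    (g : X -> U) x :
  bounded_measurable (cost M) -> minorized M' nu -> 0 < fine (nu [set: X]) ->
  bounded_measurable h -> approx_ACOE M eps r h g ->
  (forall xu, `|qval M h xu - qval M' h xu| <= e) ->
  satisfies_ACOE M' f ->
  (avg_cost M x (stationary f) <=
    (r + 2 * (e + eps) / fine (nu [set: X]))%R%:E)%E.
Proof.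
move=> bc nuM nu0 bh [lo up] he [r' [h' [mh' [C' h'C] acoe]]].
have bh' : bounded_measurable h' by split => //; exists C'.
pose d x := h' x - h x.
have bd : bounded_measurable d by exact: bounded_measurableB.
have qd xu : qval M' h' xu = qval M' h xu + \int[trans M' xu]_x d x.
  by rewrite -qvalD//; congr (_ + _); apply: eq_Rintegral => y _; rewrite /d addrC subrK.
have h'E y : r' + h' y = qval M' h' (y, f y) by case: (acoe y).
have h'min y u : r' + h' y <= qval M' h' (y, u).
  by case: (acoe y) => _ [_]; apply; exists u.
have k0 := minorized_mass_le1 nuM.
set n := fine (nu [set: X]) in nu0 k0 *.
have [_ [D dD]] := bd.
have has_span : has_sup (range (fun z : X * X => d z.1 - d z.2)).
  split; first by exists (d point - d point), (point, point).
  exists (2 * D) => _ [[y z] _ <-] /=; have := dD y; have := dD z.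
  by rewrite !ler_norml => /andP[? ?] /andP[? ?]; lra.
pose s := sup (range (fun z : X * X => d z.1 - d z.2)).
have ds y z : d y - d z <= s.
  by apply: (ub_le_sup has_span.2); exists (y, z).
have gap xu xu' := minorized_gap xu xu' nuM bd ds.
have sE : s <= 2 * (e + eps) / n.
  rewrite ler_pdivlMr//.
  suff : s <= 2 * (e + eps) + (1 - n) * s by lra.
  apply: ge_sup; first exact: has_span.1.
  move=> _ [[y z] _ <-] /=.
  have := gap (y, g y) (z, f z); rewrite -/n.
  have := h'E z; have := h'min y (g y); rewrite !qd.
  have := up y; have := lo z (f z); have := he (y, g y); have := he (z, f z).
  rewrite !ler_norml /d => /andP[a1 a2] /andP[a3 a4] a5 a6 a7 a8 a9.
  lra.
apply: (avg_cost_stationary_le bc _ bh) => y.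
have := gap (y, g y) (y, f y); rewrite -/n.
have := h'E y; have := h'min y (g y); rewrite !qd.
have := up y; have := he (y, g y); have := he (y, f y).
have nB : (1 - n) * (2 * (e + eps) / n) = 2 * (e + eps) / n - 2 * (e + eps).
  by field; lra.
have := ler_wpM2l k0 sE; rewrite -/n nB.
have eps0 : 0 <= eps by have := lo y (g y); have := up y; lra.
rewrite !ler_norml => b0 /andP[b1 b2] /andP[b3 b4] b5 b6 b7 b8.
lra.
Qed.

End minorized_models.

(** * Powers with exponents in (0, 1] *)

Section powers.
Context {R : realType}.
Implicit Types a r delta v c : R.

(** Young's inequality for the product of r^delta and a^(1 - delta), divided by
    a^(1 - delta). *)
Lemma powR_le_tangent a r delta : 0 < a -> 0 <= r -> 0 < delta <= 1 ->
  r `^ delta <= delta * a `^ (delta - 1) * r + (1 - delta) * a `^ delta.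
Proof.
move=> a0 r0 /andP[d0]; rewrite le_eqVlt => /predU1P[->|d1].
  by rewrite powRr1// subrr powRr0 !mul1r mul0r addr0.
have d10 : 0 < 1 - delta by rewrite subr_gt0.
have := @conjugate_powR _ (r `^ delta) (a `^ (1 - delta)) delta^-1 (1 - delta)^-1
  (powR_ge0 _ _) (powR_ge0 _ _).
rewrite !invr_gt0 !invrK d0 d10 => /(_ isT isT); rewrite addrC subrK => /(_ erefl).
rewrite -!powRrM !mulfV ?gt_eqF// !powRr1 ?(ltW a0)// => young.
have aa : a `^ (1 - delta) * a `^ (delta - 1) = 1.
  rewrite -powRD; last by apply/implyP => _; rewrite gt_eqF.
  by rewrite (_ : _ + _ = 0) ?powRr0//; ring.
have aE : a * a `^ (delta - 1) = a `^ delta.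
  by rewrite mulr_powRB1// ltW.
have := ler_wpM2r (powR_ge0 a (delta - 1)) young.
rewrite -[X in X <= _ -> _]mulrA aa mulr1 mulrDl => /le_trans; apply.
by rewrite -aE le_eqVlt; apply/orP; left; apply/eqP; ring.
Qed.

(** Tangents of r^delta exist only at a > 0; this supplies the limit case
    I = 0 of the bounds obtained from them. *)
Lemma le_powR_limit c I delta v : 0 <= c -> 0 <= I -> 0 < delta ->
  (forall a, 0 < a -> I <= a -> v <= c * a `^ delta) -> v <= c * I `^ delta.
Proof.
move=> c0; rewrite le_eqVlt => /predU1P[<-|I0] d0 vca; last exact: vca.
rewrite powR0 ?gt_eqF// mulr0 leNgt; apply/negP => v0.
have c_gt0 : 0 < c.
  rewrite lt_neqAle c0 andbT; apply/eqP => c00.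
  by have := vca 1 ltr01 ler01; rewrite -c00 mul0r leNgt v0.
pose a := (v / (2 * c)) `^ delta^-1.
have vc : 0 < v / (2 * c) by rewrite divr_gt0// mulr_gt0.
have := vca a (powR_gt0 _ vc) (powR_ge0 _ _).
have -> : a `^ delta = v / (2 * c) by rewrite -powRrM mulVf ?gt_eqF// powRr1// ltW.
have -> : c * (v / (2 * c)) = v / 2 by field; rewrite gt_eqF.
by rewrite leNgt ltr_pdivrMr// mulr_natr mulr2n ltrDl v0.
Qed.

Lemma powR_split r s delta : 0 <= r <= s -> 0 < delta <= 1 ->
  r <= s `^ (1 - delta) * r `^ delta.
Proof.
move=> /andP[r0 rs] /andP[d0 d1].
move: r0 rs; rewrite le_eqVlt => /predU1P[<-|r0] rs.
  by rewrite powR0 ?gt_eqF// mulr0.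
rewrite -[leLHS](powRr1 (ltW r0)) -[X in r `^ X](subrK delta 1).
rewrite powRD; last by apply/implyP => _; rewrite gt_eqF.
rewrite ler_wpM2r ?powR_ge0// ge0_ler_powR ?nnegrE ?subr_ge0// ?ltW//.
exact: lt_le_trans rs.
Qed.

(** Jensen's inequality, by integrating the tangent bound. *)
Lemma mean_powR_le d (T : measurableType d) (m : {measure set T -> \bar R})
    (g : T -> R) delta :
  m [set: T] = 1%E -> 0 < delta <= 1 -> bounded_measurable g ->
  (forall x, 0 <= g x) ->
  \int[m]_x g x `^ delta <= (\int[m]_x g x) `^ delta.
Proof.
move=> m1 d01 bg g0; have /andP[d0 d1] := d01; have [mg [C gC]] := bg.
have bgd : bounded_measurable (fun x => g x `^ delta).
  split; first exact: measurableT_comp (measurable_powR delta) mg.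
  exists (C `^ delta) => x; rewrite ger0_norm ?powR_ge0//.
  have gC' : g x <= C by rewrite (le_trans _ (gC x))// ler_norm.
  by apply: ge0_ler_powR => //; rewrite ?nnegrE ?(ltW d0)// (le_trans (g0 x)).
rewrite -[leRHS]mul1r; apply: le_powR_limit => //.
  by apply: mean_ge_cst.
move=> a a0 Ia; rewrite mul1r.
have bl := bounded_measurableZ (delta * a `^ (delta - 1)) bg.
have bc : bounded_measurable (fun _ : T => (1 - delta) * a `^ delta).
  exact: bounded_measurable_cst.
apply: le_trans (mean_le m1 bgd (bounded_measurableD bl bc) _) _.
  by move=> x; exact: powR_le_tangent.
rewrite meanD// mean_cst// meanZ//.
have aE : a * a `^ (delta - 1) = a `^ delta by rewrite mulr_powRB1// ltW.
have c0 : 0 <= delta * a `^ (delta - 1) by rewrite mulr_ge0 ?powR_ge0// ltW.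
have := ler_wpM2l c0 Ia.
have -> : delta * a `^ (delta - 1) * a = delta * a `^ delta by rewrite -aE; ring.
lra.
Qed.

End powers.

(** * Compact Borel metric spaces *)

Section borel_metric.
Context {R : realType} {dX : measure_display} {X : borelMetricType R dX}.
Implicit Types f g : X -> R.

Lemma continuous_measurable f : continuous f -> measurable_fun [set: X] f.
Proof.
move=> cf; apply: (measurability _ (RGenOInfty.measurableE R)).
move=> _ [_ [a ->] <-]; rewrite setTI borelE; apply: sub_sigma_algebra.
by apply: (continuousP _).1 => //; exact: interval_open.
Qed.

Lemma lipschitz_continuous f (K : R) :
  (forall x y, f x - f y <= K * mdist x y) -> continuous f.
Proof.
move=> fK x; apply/cvgrPdist_lt => e e0; apply/nbhs_ballP.
have K0 : 0 < `|K| + 1 by rewrite ltr_wpDl.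
exists (e / (`|K| + 1)); first by rewrite /= divr_gt0.
move=> y; rewrite ballEmdist /= ltr_pdivlMr// => xye.
have KK : K * mdist x y <= mdist x y * (`|K| + 1).
  rewrite mulrC ler_wpM2l ?mdist_ge0// (le_trans (ler_norm K))// lerDl//.
have := fK x y; have := fK y x; rewrite (metric_sym y x).
by rewrite ltr_norml => ? ?; apply/andP; split; lra.
Qed.

Lemma mdist_lipschitz (a x y : X) : mdist a x - mdist a y <= 1 * mdist x y.
Proof.
by rewrite mul1r lerBlDl (metric_sym x y) metric_triangle.
Qed.

Lemma measurable_mdist (a : X) : measurable_fun [set: X] (mdist a).
Proof.
apply: continuous_measurable; apply: lipschitz_continuous; exact: mdist_lipschitz.
Qed.

Hypothesis compactX : compact [set: X].

Lemma continuous_bounded f : continuous f -> exists C, forall x, `|f x| <= C.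
Proof.
move=> cf.
have /compact_bounded[C [_ hC]] : compact (range f).
  apply: continuous_compact => //; exact: continuous_subspaceT.
by exists (C + 1) => x; apply: (hC (C + 1)); [rewrite ltrDl|exists x].
Qed.

Lemma mdist_le_diameter (x y : X) : mdist x y <= diameter X.
Proof.
have [C hC] := continuous_bounded (lipschitz_continuous (mdist_lipschitz point)).
have ub : has_ubound (range (fun z : X * X => mdist z.1 z.2)).
  exists (C + C) => _ [[a b] _ <-] /=.
  apply: le_trans (metric_triangle _ point _) _.
  rewrite (metric_sym a) lerD// (le_trans (ler_norm _))//.
by apply: ub_le_sup => //; exists (x, y).
Qed.

Lemma diameter_ge0 : 0 <= diameter X.
Proof. exact: le_trans (mdist_ge0 point point) (mdist_le_diameter _ _). Qed.

Lemma bounded_measurable_mdist (a : X) : bounded_measurable (mdist a).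
Proof.
split; first exact: measurable_mdist.
by exists (diameter X) => x; rewrite ger0_norm ?mdist_ge0// mdist_le_diameter.
Qed.

End borel_metric.

(** * Wasserstein contraction for Hoelder functions *)

(** The comparison runs through the simple functions below f, so that g may be
    the distance on the product space, whose measurability is not known. *)
Lemma ge0_integral_monotone (R : realType) d (T : measurableType d)
    (m : {measure set T -> \bar R}) (f g : T -> \bar R) :
  (forall x, 0 <= f x)%E -> (forall x, f x <= g x)%E ->
  (\int[m]_x f x <= \int[m]_x g x)%E.
Proof.
move=> f0 fg; have g0 x : (0 <= g x)%E by exact: le_trans (fg x).
rewrite !ge0_integralTE//; apply: ereal_sup_le => _ [h /= hf <-].
by exists h => //= x; exact: le_trans (hf x) (fg x).
Qed.

Section wasserstein.
Context {R : realType} {dX : measure_display} {X : borelMetricType R dX}.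
Variables m1 m2 nu : {measure set X -> \bar R}.
Hypotheses (m11 : m1 [set: X] = 1%E) (m21 : m2 [set: X] = 1%E).
Implicit Types g h : X -> R.

(** The easy half of Kantorovich-Rubinstein duality: a coupling turns the
    difference of the means into a mean of differences. *)
Lemma lipschitz_mean_gap g (lambda W : R) : 0 <= lambda ->
  bounded_measurable g -> (forall x y, g x - g y <= lambda * mdist x y) ->
  (wasserstein1 m1 m2 <= W%:E)%E -> 0 <= W ->
  \int[m1]_x g x - \int[m2]_x g x <= lambda * W.
Proof.
move=> l0 bg glip W12 W0; apply/ler_addgt0Pr => e e0.
(* A positive Lipschitz constant, so that one can divide by it and leave the
   integral of the distance untouched. *)
pose l := lambda + e / (W + 1).
have W1 : 0 < W + 1 by rewrite ltr_wpDl.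
have eW : 0 < e / (W + 1) by rewrite divr_gt0.
have l_gt0 : 0 < l by rewrite ltr_wpDl.
suff : ((l^-1 * (\int[m1]_x g x - \int[m2]_x g x))%:E <= W%:E)%E.
  rewrite lee_fin ler_pdivrMl// => /le_trans; apply.
  have -> : l * W = lambda * W + e * (W / (W + 1)) by rewrite /l; field; lra.
  rewrite lerD2l; apply: ler_piMr; first exact: ltW.
  by rewrite ler_pdivrMr// mul1r lerDl.
apply: le_trans W12; apply: le_ereal_inf_tmp => _ [gamma cpl <-].
have g1 : gamma [set: X * X] = 1%E by exact: probability_setT.
have bfst : bounded_measurable (fun z : X * X => g z.1).
  exact: bounded_measurable_comp bg.
have bsnd : bounded_measurable (fun z : X * X => g z.2).
  exact: bounded_measurable_comp bg.
have -> : \int[m1]_x g x = \int[gamma]_z g z.1.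
  apply: mean_pushforward => // A mA; rewrite -(cpl A mA).1; congr (gamma _).
  by apply/seteqP; split => [[x y] []|[x y]].
have -> : \int[m2]_x g x = \int[gamma]_z g z.2.
  apply: mean_pushforward => // A mA; rewrite -(cpl A mA).2; congr (gamma _).
  by apply/seteqP; split => [[x y] []|[x y]].
have bd := bounded_measurableZ l^-1 (bounded_measurableB bfst bsnd).
have bn : bounded_measurable (fun z : X * X => `|l^-1 * (g z.1 - g z.2)|).
  have [md [C dC]] := bd; split; last by exists C => z; rewrite normr_id.
  exact: measurableT_comp md.
rewrite -meanB// -meanZ//; last exact: bounded_measurableB.
apply: (@le_trans _ _ (\int[gamma]_z `|l^-1 * (g z.1 - g z.2)|)%:E).
  by rewrite lee_fin mean_le// => z; rewrite ler_norm.
rewrite EFin_mean//; apply: ge0_integral_monotone => z; rewrite lee_fin//.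
rewrite normrM gtr0_norm ?invr_gt0// ler_pdivrMl//.
apply: (@le_trans _ _ (lambda * mdist z.1 z.2)); last first.
  by rewrite ler_wpM2r ?mdist_ge0// lerDl ltW.
have := glip z.1 z.2; have := glip z.2 z.1; rewrite (metric_sym z.2).
by rewrite ler_norml => ? ?; apply/andP; split; lra.
Qed.

(** Contraction for a Hoelder function h.  Its inf-convolution g with
    lambda d is lambda-Lipschitz, so the transport distance controls the means
    of g; the remainder h - g has values in [0, s], and only the masses
    1 - nu(X) outside the common part nu see it.  With k = 1 - nu(X) the choice
    of lambda and s as the tangent of H r^delta at a = W / k makes the total
    lambda W + k s equal to H k a^delta. *)
Lemma hoelder_mean_gap h (H W delta : R) (k := 1 - fine (nu [set: X])) :
  (forall A, measurable A -> (nu A <= m1 A)%E) ->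
  (forall A, measurable A -> (nu A <= m2 A)%E) ->
  0 < k -> 0 <= H -> 0 < delta <= 1 -> bounded_measurable h ->
  (forall x y, h x - h y <= H * mdist x y `^ delta) ->
  (wasserstein1 m1 m2 <= W%:E)%E -> 0 <= W ->
  \int[m1]_x h x - \int[m2]_x h x <= H * k `^ (1 - delta) * W `^ delta.
Proof.
move=> nu1 nu2 k0 H0 d01 bh hH W12 W0; have /andP[d0 d1] := d01.
have [_ [C hC]] := bh.
have kE : H * k * (W / k) `^ delta = H * k `^ (1 - delta) * W `^ delta.
  rewrite -mulrA -[RHS]mulrA; congr (_ * _).
  rewrite powRM ?invr_ge0// ?ltW// -powR_inv1 ?ltW// -powRrM mulN1r mulrCA mulrC.
  rewrite -{1}(powRr1 (ltW k0)) -powRD//.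
  by apply/implyP => _; rewrite gt_eqF.
rewrite -kE; apply: le_powR_limit => //.
- by rewrite mulr_ge0// ltW.
- by rewrite divr_ge0// ltW.
move=> a a0; rewrite ler_pdivrMr// => Wa.
pose lambda := H * delta * a `^ (delta - 1).
pose s := H * (1 - delta) * a `^ delta.
have l0 : 0 <= lambda by rewrite !mulr_ge0 ?powR_ge0// ltW.
have s0 : 0 <= s by rewrite !mulr_ge0 ?powR_ge0 ?subr_ge0.
have tangent x y : h x - h y <= lambda * mdist x y + s.
  apply: le_trans (hH x y) _.
  have := ler_wpM2l H0 (powR_le_tangent a0 (mdist_ge0 x y) d01).
  by rewrite /lambda /s; lra.
pose V x := range (fun y => h y + lambda * mdist x y).
have hasV x : has_inf (V x).
  split; first by exists (h point + lambda * mdist x point), point.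
  exists (- C) => _ [y _ <-]; have := hC y; rewrite ler_norml => /andP[? _].
  by rewrite -[leLHS]addr0 lerD// mulr_ge0// mdist_ge0.
pose g x := inf (V x).
have gle x y : g x <= h y + lambda * mdist x y.
  by apply: ge_inf; [case: (hasV x)|exists y].
have gh x : g x <= h x by have := gle x x; rewrite mdistxx mulr0 addr0.
have hg x : h x <= g x + s.
  rewrite -lerBlDr; apply: lb_le_inf; first by case: (hasV x).
  by move=> _ [y _ <-]; have := tangent x y; lra.
have glip x y : g x - g y <= lambda * mdist x y.
  rewrite lerBlDl -lerBlDr; apply: lb_le_inf; first by case: (hasV y).
  move=> _ [z _ <-]; have := gle x z.
  have := ler_wpM2l l0 (metric_triangle x y z); rewrite mulrDr.
  lra.
have bg : bounded_measurable g.
  split; first exact: continuous_measurable (lipschitz_continuous glip).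
  exists (C + s) => x; have := hC x; have := gh x; have := hg x.
  by rewrite !ler_norml => ? ? /andP[? ?]; apply/andP; split; lra.
have bhg := bounded_measurableB bh bg.
have hgs x y : (h x - g x) - (h y - g y) <= s.
  by have := hg x; have := gh y; lra.
have := mean_gap m11 m21 nu1 nu2 bhg hgs.
have := lipschitz_mean_gap l0 bg glip W12 W0.
rewrite !meanB// -/k => gapg gaphg.
have aE : a * a `^ (delta - 1) = a `^ delta by rewrite mulr_powRB1// ltW.
have lW : lambda * W <= H * delta * k * a `^ delta.
  apply: le_trans (ler_wpM2l l0 Wa) _.
  by rewrite le_eqVlt -aE; apply/orP; left; apply/eqP; rewrite /lambda; ring.
have ks : k * s = H * k * a `^ delta - H * delta * k * a `^ delta.
  by rewrite /s; ring.
lra.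
Qed.

End wasserstein.

(** * One-step error of the quantized model *)

Section quantized_model.
Context {R : realType} {dX dU : measure_display}
  {X : borelMetricType R dX} {U : measurableType dU}.
Variables (M : mdp X U) (Q : quantization X).
Hypothesis bounded_cost : bounded_measurable (cost M).
Local Notation Mhat := (approx_mdp M Q).

Let bounded_section (g : X * U -> R) u :
  bounded_measurable g -> bounded_measurable (fun z => g (z, u)).
Proof. exact: bounded_measurable_comp (pair2_measurable u). Qed.

Lemma qval_approx h x u : bounded_measurable h ->
  qval Mhat h (x, u) =
  \int[bin_measure Q (bin_index Q x)]_z qval M h (z, u).
Proof.
move=> bh; have Q1 : bin_measure Q (bin_index Q x) [set: X] = 1%E.
  exact: probability_setT.
rewrite /qval [in RHS](meanD Q1); [|exact: bounded_section|]; last first.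
  apply: (bounded_section (g := fun xu => \int[trans M xu]_y h y)).
  exact: bounded_measurable_next.
by congr (_ + _); rewrite [LHS]mean_kseqcomp.
Qed.

Lemma bounded_approx_cost : bounded_measurable (cost Mhat).
Proof.
split; first exact: measurable_approx_cost.
have [_ [C cC]] := bounded_cost; exists C => -[x u].
rewrite -[X in `|X|]subr0; apply: mean_dist_le.
- exact: probability_setT.
- exact: bounded_section.
- by move=> z; rewrite subr0.
Qed.

Lemma minorized_approx nu : minorized M nu -> minorized Mhat nu.
Proof.
move=> nuM [x u] A mA; rewrite approx_transE.
apply: (@le_trans _ _ (\int[bin_measure Q (bin_index Q x)]_z nu A)%E).
  by rewrite integral_cst// [X in (_ * X)%E](_ : _ = 1%E) ?mule1//;
    exact: probability_setT.
by apply: ge0_integral_monotone => // z; exact: nuM.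
Qed.

(** The one-step values of the quantized model average those of the original
    one over a bin, hence differ from them by the mean oscillation. *)
Lemma qval_approx_dist h x u (phi : X -> R) : bounded_measurable h ->
  bounded_measurable phi ->
  (forall z, `|qval M h (x, u) - qval M h (z, u)| <= phi z) ->
  `|qval M h (x, u) - qval Mhat h (x, u)| <=
    \int[bin_measure Q (bin_index Q x)]_z phi z.
Proof.
move=> bh bphi qphi; have Q1 : bin_measure Q (bin_index Q x) [set: X] = 1%E.
  exact: probability_setT.
have bq := bounded_section u (bounded_measurable_qval bounded_cost bh).
have bc : bounded_measurable (fun _ : X => qval M h (x, u)).
  exact: bounded_measurable_cst.
rewrite qval_approx// -{1}(mean_cst Q1 (qval M h (x, u))) -meanB//.
rewrite ler_norml; apply/andP; split.
  rewrite -mulN1r -meanZ//; apply: mean_le => //.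
  - exact: bounded_measurableZ.
  - exact: bounded_measurableB.
  - by move=> z; have := qphi z; rewrite mulN1r ler_norml => /andP[].
apply: mean_le => //; first exact: bounded_measurableB.
by move=> z; have := qphi z; rewrite ler_norml => /andP[].
Qed.

Hypothesis compactX : compact [set: X].

Lemma quant_err_ge0 x : 0 <= quant_err Q x.
Proof. by apply: Rintegral_ge0 => z _; exact: mdist_ge0. Qed.

Lemma quant_err_le_max x : quant_err Q x <= max_quant_err Q.
Proof.
apply: ub_le_sup; last by exists x.
exists (diameter X) => _ [z _ <-]; apply: mean_le_cst.
- exact: probability_setT.
- exact: bounded_measurable_mdist.
- by move=> y; exact: mdist_le_diameter.
Qed.

Lemma max_quant_err_ge0 : 0 <= max_quant_err Q.
Proof. exact: le_trans (quant_err_ge0 point) (quant_err_le_max _). Qed.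

Lemma max_quant_err_eq0 : (forall x y : X, mdist x y = 0) -> max_quant_err Q = 0.
Proof.
move=> d0; apply/eqP; rewrite eq_le max_quant_err_ge0 andbT.
apply: ge_sup; first by exists (quant_err Q point), point.
move=> _ [x _ <-]; apply: mean_le_cst.
- exact: probability_setT.
- exact: bounded_measurable_mdist.
- by move=> y; rewrite d0.
Qed.

End quantized_model.

(** * Models with Lipschitz data *)

Section lipschitz_model.
Context {R : realType} {dX dU : measure_display}
  {X : borelMetricType R dX} {U : measurableType dU}.
Implicit Types (M : mdp X U) (Kc KT : R).

Lemma finite_upper_bound (g : U -> R) : finite_set [set: U] ->
  exists C, forall u, g u <= C.
Proof.
move=> /finite_seqP[s sE].
suff [C gC] : exists C, forall u, u \in s -> g u <= C.
  by exists C => u; apply: gC; have : [set: U] u by []; rewrite sE.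
elim: s {sE} => [|v s [C gC]]; first by exists 0.
exists (Num.max (g v) C) => u; rewrite in_cons le_max => /predU1P[->|/gC ->].
  by rewrite lexx.
by rewrite orbT.
Qed.

Lemma lipschitz_bounded_cost M Kc KT : lipschitz_condition M Kc KT ->
  bounded_measurable (cost M).
Proof.
move=> [compactX finiteU cK _]; split; first exact: measurable_cost.
have [C cC] := finite_upper_bound (fun u => `|cost M (point, u)|) finiteU.
exists (`|Kc| * diameter X + C) => -[x u].
rewrite -[X in `|X|](subrK (cost M (point, u))).
rewrite (le_trans (ler_normD _ _))// lerD// (le_trans (cK x point u))//.
apply: (le_trans (ler_wpM2r (mdist_ge0 _ _) (ler_norm Kc))).
by rewrite ler_wpM2l// mdist_le_diameter.
Qed.

Lemma lipschitz_condition_max0 M Kc KT : lipschitz_condition M Kc KT ->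
  lipschitz_condition M (Num.max Kc 0) (Num.max KT 0).
Proof.
move=> [cX fU cK TK]; split => // x y u.
  by apply: (le_trans (cK x y u)); rewrite ler_wpM2r ?mdist_ge0// le_max lexx.
apply: (le_trans (TK x y u)).
by rewrite lee_fin ler_wpM2r ?mdist_ge0// le_max lexx.
Qed.

(** A negative Lipschitz constant forces the space to be a point. *)
Lemma lipschitz_constant_neg M Kc KT : lipschitz_condition M Kc KT ->
  (Kc < 0) || (KT < 0) -> forall x y : X, mdist x y = 0.
Proof.
move=> [_ _ cK TK] neg x y.
have [K [K0 Kd]] : exists K : R, K < 0 /\ 0 <= K * mdist x y.
  case/orP: neg => neg; [exists Kc|exists KT]; split => //.
    exact: le_trans (cK x y point).
  rewrite -lee_fin; apply: le_trans (TK x y point).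
  apply: le_ereal_inf_tmp => _ [g _ <-]; apply: integral_ge0 => z _.
  by rewrite lee_fin mdist_ge0.
by apply/eqP; rewrite eq_le mdist_ge0 andbT -(nmulr_rge0 _ K0).
Qed.

Section hoelder.
Variables (M : mdp X U) (nu : {measure set X -> \bar R}) (Kc KT delta : R).
Let k := 1 - fine (nu [set: X]).
Let D := diameter X.
Let K := Kc * D `^ (1 - delta) / (1 - KT `^ delta * k `^ (1 - delta)).
Hypotheses (lipM : lipschitz_condition M Kc KT) (Kc0 : 0 <= Kc) (KT0 : 0 <= KT)
  (nuM : minorized M nu) (k0 : 0 < k) (d01 : 0 < delta <= 1)
  (contract : KT `^ delta * k `^ (1 - delta) < 1).

Let compactX : compact [set: X]. Proof. by case: lipM. Qed.
Let finiteU : finite_set [set: U]. Proof. by case: lipM. Qed.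
Let bc := lipschitz_bounded_cost lipM.

Let K0 : 0 <= K.
Proof. by rewrite divr_ge0// ?mulr_ge0 ?powR_ge0// subr_ge0 ltW. Qed.

(** K is the fixed point of the Hoelder constant under dynamic programming. *)
Let KE : Kc * D `^ (1 - delta) + K * (KT `^ delta * k `^ (1 - delta)) = K.
Proof.
by rewrite /K; field; rewrite subr_eq0 eq_sym lt_eqF.
Qed.

Lemma qval_hoelder b h x y u : 0 <= b <= 1 -> bounded_measurable h ->
  (forall x y, h x - h y <= K * mdist x y `^ delta) ->
  qval M (fun z => b * h z) (x, u) - qval M (fun z => b * h z) (y, u) <=
  K * mdist x y `^ delta.
Proof.
move=> /andP[b0 b1] bh hK; have [_ _ cK TK] := lipM.
have /andP[d0 _] := d01.
have T1 xu : trans M xu [set: X] = 1%E by exact: prob_kernel.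
rewrite /qval !meanZ//.
have W0 : 0 <= KT * mdist x y by rewrite mulr_ge0// mdist_ge0.
have := hoelder_mean_gap (T1 (x, u)) (T1 (y, u)) (fun A => @nuM (x, u) A)
  (fun A => @nuM (y, u) A) k0 K0 d01 bh hK (TK x y u) W0.
rewrite -/k (powRM _ KT0) ?mdist_ge0// => hgap.
have gap0 : 0 <= K * k `^ (1 - delta) * (KT `^ delta * mdist x y `^ delta).
  by apply: mulr_ge0; apply: mulr_ge0 => //; exact: powR_ge0.
have {}hgap := le_trans (ler_wpM2l b0 hgap) (ler_piMl gap0 b1).
have := cK x y u; rewrite ler_norml => /andP[_ cxy].
have cd : Kc * mdist x y <= Kc * (D `^ (1 - delta) * mdist x y `^ delta).
  rewrite ler_wpM2l//; apply: powR_split => //.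
  by rewrite mdist_ge0 mdist_le_diameter.
by rewrite -[in leRHS]KE; lra.
Qed.

Lemma hoelder_approx_ACOE e : 0 < e ->
  exists r h (f : {mfun X >-> U}), [/\ bounded_measurable h,
    forall x y, h x - h y <= K * mdist x y `^ delta & approx_ACOE M e r h f].
Proof.
move=> e0; have /andP[d0 _] := d01.
pose P (h : X -> R) := bounded_measurable h /\
  forall x y, h x - h y <= K * mdist x y `^ delta.
have [||||r [h [f [[bh hK] hf]]]] :=
    @exists_approx_ACOE _ _ _ _ _ finiteU M bc P (K * D `^ delta) _ _ _ _ e e0.
- by move=> h [].
- move=> h x y [_ hK]; apply: le_trans (hK x y) _; rewrite ler_wpM2l//.
  apply: ge0_ler_powR; rewrite ?nnegrE ?(ltW d0) ?mdist_ge0//.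
  + exact: diameter_ge0.
  + exact: mdist_le_diameter.
- split; first exact: bounded_measurable_cst.
  by move=> x y; rewrite subrr mulr_ge0// powR_ge0.
- move=> b f v w b01 [bv vK] mw [wmin wE].
  have bq := bounded_measurable_qval bc (bounded_measurableZ b bv).
  split.
    by split => //; have [_ [C qC]] := bq; exists C => x; rewrite wE.
  move=> x y; have := wmin x (f y); rewrite (wE y).
  by have := qval_hoelder x y (f y) b01 bv vK; lra.
by exists r, h, f; split.
Qed.

Lemma qval_approx_hoelder (Q : quantization X) h xu : bounded_measurable h ->
  (forall x y, h x - h y <= K * mdist x y `^ delta) ->
  `|qval M h xu - qval (approx_mdp M Q) h xu| <= K * max_quant_err Q `^ delta.
Proof.
case: xu => x u bh hK; have /andP[d0 d1] := d01.
have Q1 : bin_measure Q (bin_index Q x) [set: X] = 1%E by exact: probability_setT.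
have bd : bounded_measurable (fun z => mdist x z `^ delta).
  split; first exact: measurableT_comp (measurable_powR delta) (measurable_mdist x).
  exists (D `^ delta) => z; rewrite ger0_norm ?powR_ge0//.
  apply: ge0_ler_powR; rewrite ?nnegrE ?(ltW d0) ?mdist_ge0//.
  + exact: diameter_ge0.
  + exact: mdist_le_diameter.
have q1 z z' : qval M h (z, u) - qval M h (z', u) <= K * mdist z z' `^ delta.
  have := @qval_hoelder 1 h z z' u _ bh hK; rewrite ler01 lexx => /(_ isT).
  by rewrite (_ : (fun z => 1 * h z) = h)//; apply/funext => ?; rewrite mul1r.
apply: le_trans (qval_approx_dist Q bc bh (bounded_measurableZ K bd) _) _.
  by move=> z; rewrite ler_norml q1 andbT lerNl opprB metric_sym q1.
rewrite meanZ// ler_wpM2l//.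
apply: le_trans (mean_powR_le Q1 d01 (bounded_measurable_mdist compactX x) _) _.
  by move=> z; exact: mdist_ge0.
apply: ge0_ler_powR; rewrite ?nnegrE ?(ltW d0)//.
- exact: quant_err_ge0.
- exact: max_quant_err_ge0.
- exact: quant_err_le_max.
Qed.

End hoelder.

End lipschitz_model.

(** * Models with weakly continuous transitions *)

Section sequential_continuity.
Context {R : realType} {dX : measure_display} {X : borelMetricType R dX}.

Lemma sequential_continuous (f : X -> R) :
  (forall (z : nat -> X) x, z @ \oo --> x -> f (z n) @[n --> \oo] --> f x) ->
  continuous f.
Proof.
move=> fseq x; apply/cvgrPdist_lt => e e0; apply: contrapT => nfx.
have bad n : exists y, mdist x y < n.+1%:R^-1 /\ e <= `|f x - f y|.
  apply: contrapT => nbad; apply: nfx; apply/nbhs_ballP.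
  exists n.+1%:R^-1 => /=; first by rewrite invr_gt0.
  move=> y; rewrite ballEmdist /= => xy; rewrite ltNge; apply/negP => fxy.
  by apply: nbad; exists y.
have [z zP] := choice bad.
have zx : z @ \oo --> x.
  apply/cvg_ballP => r r0.
  have [N _ NP] := near_infty_natSinv_lt (PosNum r0).
  by exists N => // n /NP nr; rewrite ballEmdist /=; exact: lt_trans (zP n).1 nr.
have /cvgrPdist_lt /(_ e e0) [N _ /(_ N (leqnn N))] := fseq z x zx.
by rewrite ltNge (zP N).2.
Qed.

End sequential_continuity.

Lemma finite_near (T : Type) (U : choiceType) (F : set_system T)
    (P : U -> T -> Prop) :
  Filter F -> finite_set [set: U] ->
  (forall u, \forall x \near F, P u x) -> \forall x \near F, forall u, P u x.
Proof.
move=> FF /finite_seqP[s sE] FP.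
suff : \forall x \near F, forall u, u \in s -> P u x.
  by apply: filterS => x Px u; apply: Px; have : [set: U] u by []; rewrite sE.
elim: s {sE} => [|v s IH]; first exact: nearW.
apply: filterS2 (FP v) IH => x Pv Ps u.
by rewrite in_cons => /predU1P[->|/Ps].
Qed.

Section weakly_continuous_model.
Context {R : realType} {dX dU : measure_display}
  {X : borelMetricType R dX} {U : measurableType dU}.
Variable M : mdp X U.
Hypothesis wc : weak_continuity_condition M.

Let finiteU : finite_set [set: U]. Proof. by case: wc. Qed.
Let compactX : compact [set: X]. Proof. by case: wc. Qed.

Lemma weak_bounded_cost : bounded_measurable (cost M).
Proof. by case: wc => _ _ bc _ _; split => //; exact: measurable_cost. Qed.

Lemma continuous_qval h u : bounded_measurable h -> continuous h ->
  continuous (fun x => qval M h (x, u)).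
Proof.
move=> bh ch; apply: sequential_continuous => z x zx.
have [_ _ _ cc cT] := wc.
have zxu : cvg_state_action (fun n => (z n, u)) (x, u).
  by split; [exact: zx|exact: nearW].
apply: cvgD; first exact: cc zxu.
have := cT _ _ zxu h ch bh.2.
have T1 xu : trans M xu [set: X] = 1%E by exact: prob_kernel.
rewrite -EFin_mean// (_ : (fun n => _) =
  (fun n => (\int[trans M (z n, u)]_y h y)%:E)); last first.
  by apply/funext => n; rewrite EFin_mean.
by move=> /fine_cvgP[].
Qed.

Lemma near_qval h x (e : R) : bounded_measurable h -> continuous h -> 0 < e ->
  \forall y \near x, forall u, `|qval M h (x, u) - qval M h (y, u)| < e.
Proof.
move=> bh ch e0; apply: finite_near => // u.
have cq := @continuous_qval h u bh ch.
by have /cvgrPdist_lt := cq x; exact.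
Qed.

(** A minimum of finitely many functions continuous at x is continuous at x. *)
Lemma continuous_discounted_update b f v w : bounded_measurable v ->
  continuous v -> discounted_update M b f v w -> continuous w.
Proof.
move=> bv cv [wmin wE] x; apply/cvgrPdist_lt => e e0.
have bbv := bounded_measurableZ b bv.
have cbv : continuous (fun y => b * v y).
  by move=> y; apply: cvgMr; exact: cv.
apply: filterS (near_qval x bbv cbv e0) => y qxy.
have := qxy (f x); have := qxy (f y); rewrite -wE -wE !ltr_norml.
have := wmin x (f y); have := wmin y (f x).
by move=> ? ? /andP[? ?] /andP[? ?]; apply/andP; split; lra.
Qed.

Lemma uniform_qval h (e : R) : bounded_measurable h -> continuous h -> 0 < e ->
  exists2 theta, 0 < theta &
    forall x y u, mdist x y < theta -> `|qval M h (x, u) - qval M h (y, u)| < e.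
Proof.
move=> bh ch e0.
(* Near every x the action values oscillate by less than e / 2; compactness makes
   the radius uniform. *)
pose P (theta : R) (x : X) := forall y u,
  mdist x y < theta -> `|qval M h (x, u) - qval M h (y, u)| < e.
have e20 : 0 < e / 2 by rewrite divr_gt0.
suff unif : \forall theta \near 0^'+, [set: X] `<=` P theta.
  have [theta [theta0 Ptheta]] := filter_ex (filterI (nbhs_right_gt 0) unif).
  by exists theta => // x y u; exact: (Ptheta x).
apply: (compact_near_coveringP _).1 => // x _.
have /nbhs_ballP[r /= r0 rP] := near_qval x bh ch e20.
have r20 : 0 < r / 2 by rewrite divr_gt0.
exists (ball x (r / 2), [set theta | theta < r / 2]) => /=.
  by split; [exact: nbhsx_ballx|exact: nbhs_right_lt].
move=> [x' theta] /= [xx' thr] y u x'y.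
rewrite ballEmdist /= in xx'.
have b1 : ball x r x' by rewrite ballEmdist /=; lra.
have b2 : ball x r y.
  by rewrite ballEmdist /=; have := metric_triangle x x' y; lra.
have := rP _ b1 u; have := rP _ b2 u; rewrite !ltr_norml.
by move=> /andP[? ?] /andP[? ?]; apply/andP; split; lra.
Qed.

Variable nu : {measure set X -> \bar R}.
Hypotheses (nuM : minorized M nu) (nu0 : 0 < fine (nu [set: X])).

Lemma continuous_approx_ACOE (e : R) : 0 < e ->
  exists r h (f : {mfun X >-> U}), [/\ bounded_measurable h, continuous h &
    approx_ACOE M e r h f].
Proof.
move=> e0; apply: (minorized_approx_ACOE finiteU weak_bounded_cost nuM nu0) => //.
  by move=> x; exact: cvg_cst.
move=> b f v w _ bv cv _; exact: continuous_discounted_update.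
Qed.

(** Beyond the distance theta of uniform continuity the oscillation of the
    one-step values is at most a constant times the distance, whose mean is the
    quantization error. *)
Lemma qval_approx_uniform h (e : R) : bounded_measurable h -> continuous h -> 0 < e ->
  exists C, forall (Q : quantization X) xu,
    `|qval M h xu - qval (approx_mdp M Q) h xu| <= e + C * max_quant_err Q.
Proof.
move=> bh ch e0; have [theta th0 thP] := uniform_qval bh ch e0.
have bq := bounded_measurable_qval weak_bounded_cost bh.
have [_ [B qB]] := bq.
have B0 : 0 <= B by apply: le_trans (qB point).
exists (2 * B / theta) => Q [x u].
have C0 : 0 <= 2 * B / theta by rewrite divr_ge0 ?mulr_ge0// ltW.
have Q1 : bin_measure Q (bin_index Q x) [set: X] = 1%E by exact: probability_setT.
have bd := bounded_measurableZ (2 * B / theta) (bounded_measurable_mdist compactX x).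
have be : bounded_measurable (fun _ : X => e) by exact: bounded_measurable_cst.
apply: le_trans (qval_approx_dist Q weak_bounded_cost bh
  (bounded_measurableD be bd) _) _.
  move=> z; have [zth|zth] := ltP (mdist x z) theta.
    by rewrite (le_trans (ltW (thP _ _ u zth)))// lerDl mulr_ge0// mdist_ge0.
  apply: (@le_trans _ _ (2 * B)).
    have := qB (x, u); have := qB (z, u); rewrite !ler_norml.
    by move=> /andP[? ?] /andP[? ?]; apply/andP; split; lra.
  apply: (@le_trans _ _ (2 * B / theta * theta)).
    by rewrite divfK// gt_eqF.
  by apply: (le_trans (ler_wpM2l C0 zth)); rewrite lerDr ltW.
rewrite meanD// mean_cst// meanZ//; last exact: bounded_measurable_mdist.
by rewrite lerD2l ler_wpM2l//; exact: quant_err_le_max.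
Qed.

End weakly_continuous_model.

(** * Comparison of the original and the quantized model *)

Section comparison.
Context {R : realType} {dX dU : measure_display}
  {X : borelMetricType R dX} {U : measurableType dU}.
Implicit Types M : mdp X U.

(** The same constant, function and policy solve both optimality equations, with
    errors e and e + E, and e is arbitrary. *)
Lemma opt_cost_gap M M' (E : R) :
  bounded_measurable (cost M) -> bounded_measurable (cost M') ->
  (forall e : R, 0 < e -> exists r h (f : {mfun X >-> U}),
    [/\ bounded_measurable h, approx_ACOE M e r h f &
      forall xu, `|qval M h xu - qval M' h xu| <= E]) ->
  exists rho, (forall x, opt_cost M x = rho%:E) /\
    (forall x, (`|rho%:E - opt_cost M' x| <= E%:E)%E).
Proof.
move=> bc bc' sol.
have [rho rhoE] : exists rho, forall x, opt_cost M x = rho%:E.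
  apply: constant_of_approx => e e0; have [r [h [f [bh hf _]]]] := sol e e0.
  exists r => x; exact: (approx_ACOE_opt_cost bc x bh hf).
exists rho; split=> // x.
have near (e : R) : 0 < e -> ((rho - E - 2 * e)%R%:E <= opt_cost M' x)%E /\
    (opt_cost M' x <= (rho + E + 2 * e)%R%:E)%E.
  move=> e0; have [r [h [f [bh hf hE]]]] := sol e e0.
  have := approx_ACOE_opt_cost bc x bh hf; rewrite rhoE !lee_fin => -[rl ru].
  have hf' : approx_ACOE M' (e + E) r h f.
    case: hf => lo up; split => [y u|y].
      by have := lo y u; have := hE (y, u); rewrite ler_norml => /andP[? ?]; lra.
    by have := up y; have := hE (y, f y); rewrite ler_norml => /andP[? ?]; lra.
  have [l u] := approx_ACOE_opt_cost bc' x bh hf'.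
  split; [apply: le_trans l|apply: (le_trans u)]; rewrite lee_fin; lra.
have fin : opt_cost M' x \is a fin_num.
  have [l u] := near 1 ltr01.
  rewrite fin_numE; apply/andP; split; apply/eqP => ax.
    by move: l; rewrite ax leeNy_eq.
  by move: u; rewrite ax leye_eq.
rewrite -(fineK fin) in near *; move: (fine _) near => rho' near.
rewrite -EFinB lee_fin; apply/ler_addgt0Pr => e e0.
have e20 : 0 < e / 2 by rewrite divr_gt0.
have [] := near _ e20; rewrite !lee_fin => ? ?.
by rewrite ler_norml; apply/andP; split; lra.
Qed.

(** Raise the hypothesis to the power delta. *)
Lemma contraction_lt1 (KT k delta : R) : 0 <= KT -> 0 < k -> 0 < delta ->
  KT < (1 / k) `^ ((1 - delta) / delta) -> KT `^ delta * k `^ (1 - delta) < 1.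
Proof.
move=> KT0 k0 d0 KTk.
have : KT `^ delta < ((1 / k) `^ ((1 - delta) / delta)) `^ delta.
  by apply: gt0_ltr_powR; rewrite ?nnegrE ?powR_ge0.
rewrite -powRrM divfK ?gt_eqF// => KTd.
have kd : 0 < k `^ (1 - delta) by exact: powR_gt0.
apply: (lt_le_trans (_ : _ < (1 / k) `^ (1 - delta) * k `^ (1 - delta))).
  by rewrite ltr_pM2r.
have k10 : 0 <= 1 / k by rewrite divr_ge0// ltW.
by rewrite -(powRM _ k10 (ltW k0)) divfK ?gt_eqF// powR1.
Qed.

(** Lipschitz constants may be taken nonnegative: otherwise the space is a
    point and the quantization error vanishes. *)
Lemma lipschitz_constants_max0 M (Kc KT : R) : lipschitz_condition M Kc KT ->
  (Num.max Kc 0 = Kc /\ Num.max KT 0 = KT) \/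
  (forall Q : quantization X, max_quant_err Q = 0).
Proof.
move=> lip; have [neg|] := boolP ((Kc < 0) || (KT < 0)).
  have [cX _ _ _] := lip.
  right=> Q; apply: max_quant_err_eq0 => //.
  exact: lipschitz_constant_neg lip neg.
by rewrite negb_or -!leNgt => /andP[? ?]; left; split; apply: max_l.
Qed.

Lemma lipschitz_common_solution M (nu : {measure set X -> \bar R})
    (Q : quantization X) (Kc KT delta : R) (k := 1 - fine (nu [set: X])) :
  lipschitz_condition M Kc KT -> minorized M nu ->
  0 < k -> 0 < delta <= 1 -> KT < (1 / k) `^ ((1 - delta) / delta) ->
  forall e : R, 0 < e -> exists r h (f : {mfun X >-> U}),
  [/\ bounded_measurable h, approx_ACOE M e r h f &
    forall xu, `|qval M h xu - qval (approx_mdp M Q) h xu| <=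
      Kc * diameter X `^ (1 - delta) / (1 - KT `^ delta * k `^ (1 - delta))
      * max_quant_err Q `^ delta].
Proof.
move=> lip nuM k0 d01 KTk e e0; have /andP[d0 _] := d01.
pose Kc' := Num.max Kc 0; pose KT' := Num.max KT 0.
have lip' : lipschitz_condition M Kc' KT' by exact: lipschitz_condition_max0.
have Kc0 : 0 <= Kc' by rewrite le_max lexx orbT.
have KT0 : 0 <= KT' by rewrite le_max lexx orbT.
have ctr : KT' `^ delta * k `^ (1 - delta) < 1.
  by apply: contraction_lt1 => //; rewrite gt_max KTk powR_gt0// divr_gt0.
have [r [h [f [bh hK hf]]]] := hoelder_approx_ACOE lip' Kc0 KT0 nuM k0 d01 ctr e0.
exists r, h, f; split => // xu.
apply: le_trans (qval_approx_hoelder lip' Kc0 KT0 nuM k0 d01 ctr Q xu bh hK) _.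
rewrite /Kc' /KT'; case: (lipschitz_constants_max0 lip) => [[-> ->]//|->].
by rewrite powR0 ?gt_eqF// !mulr0.
Qed.

(** The limit eps -> 0 of avg_cost_transfer. *)
Lemma policy_gap M M' (nu : {measure set X -> \bar R}) (f : {mfun X >-> U})
    (E rho rho_f : R) :
  bounded_measurable (cost M) -> minorized M' nu -> 0 < fine (nu [set: X]) ->
  (forall e : R, 0 < e -> exists r h (g : {mfun X >-> U}),
    [/\ bounded_measurable h, approx_ACOE M e r h g &
      forall xu, `|qval M h xu - qval M' h xu| <= E]) ->
  (forall x, opt_cost M x = rho%:E) -> satisfies_ACOE M' f ->
  (forall x, avg_cost M x (stationary f) = rho_f%:E) ->
  rho_f - rho <= 2 * E / fine (nu [set: X]).
Proof.
move=> bc nuM nu0 sol rhoE acoe rhofE; apply/ler_addgt0Pr => e e0.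
set n := fine _ in nu0 *.
have n20 : 0 < 1 + 2 / n by rewrite addr_gt0// divr_gt0.
(* The accuracy e' enters twice: in the transferred bound, and in the distance
   between r and rho. *)
pose e' := e / (1 + 2 / n); have e'0 : 0 < e' by rewrite divr_gt0.
have [r [h [g [bh hg hE]]]] := sol _ e'0.
have := approx_ACOE_opt_cost bc point bh hg; rewrite rhoE !lee_fin => -[rl _].
have := avg_cost_transfer point bc nuM nu0 bh hg hE acoe.
rewrite rhofE lee_fin -/n.
have -> : 2 * (E + e') / n = 2 * E / n + e' * (1 + 2 / n) - e' by field; lra.
have -> : e' * (1 + 2 / n) = e by rewrite divfK// gt_eqF.
lra.
Qed.

(** The approximate solution h is fixed before n, so that the models of index n
    approach the original one on h. *)
Lemma near_optimal_policies M (nu : {measure set X -> \bar R})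
    (Q : nat -> quantization X) (pi : nat -> {mfun X >-> U})
    (rho : R) (rho_pi : nat -> R) :
  weak_continuity_condition M -> minorized M nu -> 0 < fine (nu [set: X]) ->
  (forall n, (1 <= n)%N -> max_quant_err (Q n) = n%:R^-1) ->
  (forall n, (1 <= n)%N -> satisfies_ACOE (approx_mdp M (Q n)) (pi n)) ->
  (forall x, opt_cost M x = rho%:E) ->
  (forall n, (1 <= n)%N ->
    forall x, avg_cost M x (stationary (pi n)) = (rho_pi n)%:E) ->
  rho_pi n @[n --> \oo] --> rho.
Proof.
move=> wc nuM nu0 LE acoe rhoE rho_piE; have bc := weak_bounded_cost wc.
set m := fine _ in nu0.
apply/cvgrPdist_le => e e0.
have m60 : 0 < 1 + 6 / m by rewrite addr_gt0// divr_gt0.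
(* Once n is large, 2 e' bounds the distance of the models on h, so that the
   transferred bound is r + 6 e' / m; moreover r <= rho + e'. *)
pose e' := e / (1 + 6 / m); have e'0 : 0 < e' by rewrite divr_gt0.
have [r [h [g [bh ch hg]]]] := continuous_approx_ACOE wc nuM nu0 e'0.
have [C hC] := qval_approx_uniform wc bh ch e'0.
exists (Num.truncn (C / e')).+1 => // n /= Nn.
have n1 : (1 <= n)%N by exact: leq_trans Nn.
have n0 : (0 : R) < n%:R by rewrite ltr0n.
have Cn : C * n%:R^-1 <= e'.
  rewrite ler_pdivrMr// (mulrC e') -ler_pdivrMr//.
  by apply: (le_trans (ltW (truncnS_gt _))); rewrite ler_nat.
have hE xu : `|qval M h xu - qval (approx_mdp M (Q n)) h xu| <= 2 * e'.
  by apply: (le_trans (hC (Q n) xu)); rewrite LE//; lra.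
have nuMn : minorized (approx_mdp M (Q n)) nu by exact: minorized_approx.
have := opt_cost_le M (stationary (pi n)) point.
rewrite rhoE rho_piE// lee_fin => rho_le.
have := approx_ACOE_opt_cost bc point bh hg; rewrite rhoE !lee_fin => -[rl _].
have := avg_cost_transfer point bc nuMn nu0 bh hg hE (acoe n n1).
rewrite rho_piE// lee_fin -/m.
have -> : 2 * (2 * e' + e') / m = e' * (1 + 6 / m) - e' by field; lra.
have -> : e' * (1 + 6 / m) = e by rewrite divfK// gt_eqF.
move=> ?.
by rewrite ler_norml; apply/andP; split; lra.
Qed.

End comparison.

Theorem theorem16 (R : realType) (dX dU : measure_display)
    (X : borelMetricType R dX) (U : measurableType dU)
    (compactX : compact [set: X])
    (finiteU : finite_set [set: U])
    (discreteU : forall A : set U, measurable A)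
    (M : mdp X U) :
  [/\
    (* (i) *)
    forall (Q : quantization X) (Kc KT : R),
      lipschitz_condition M Kc KT -> KT < 1 ->
      exists rho : R,
        (forall x0, opt_cost M x0 = rho%:E) /\
        (forall x0,
          (`|rho%:E - opt_cost (approx_mdp M Q) x0|
             <= (Kc / (1 - KT) * max_quant_err Q)%:E)%E),

    (* (ii) *)
    forall (Q : quantization X) (nu : {measure set X -> \bar R}) (Kc KT : R),
      let D := diameter X in
      let L := max_quant_err Q in
      let kappa := 1 - fine (nu [set: X]) in
      minorization M nu -> 0 < kappa -> lipschitz_condition M Kc KT ->
      exists rho rhohat : R,
        [/\ forall x0, opt_cost M x0 = rho%:E,
            forall x0, opt_cost (approx_mdp M Q) x0 = rhohat%:E,
            forall delta : R, 0 < delta <= 1 ->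
              KT < (1 / kappa) `^ ((1 - delta) / delta) ->
              `|rho - rhohat|
                <= Kc * D `^ (1 - delta)
                     / (1 - KT `^ delta * kappa `^ (1 - delta)) * L `^ delta
          & forall pihat : {mfun X >-> U},
              optimal (approx_mdp M Q) (stationary pihat) ->
              satisfies_ACOE (approx_mdp M Q) pihat ->
              exists rho_pihat : R,
                (forall x0,
                   avg_cost M x0 (stationary pihat) = rho_pihat%:E) /\
                (forall delta : R, 0 < delta <= 1 ->
                   KT < (1 / kappa) `^ ((1 - delta) / delta) ->
                   rho_pihat - rho
                     <= 2 * Kc * D `^ (1 - delta)
                          / ((1 - kappa)
                             * (1 - KT `^ delta * kappa `^ (1 - delta)))
                          * L `^ delta)]
  & (* (iii) *)
    forall (nu : {measure set X -> \bar R}),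
      minorization M nu -> 0 < 1 - fine (nu [set: X]) ->
      weak_continuity_condition M ->
      forall (Q : nat -> quantization X) (pi : nat -> {mfun X >-> U}),
        (forall n, (1 <= n)%N ->
           [/\ max_quant_err (Q n) = n%:R^-1,
               optimal (approx_mdp M (Q n)) (stationary (pi n))
             & satisfies_ACOE (approx_mdp M (Q n)) (pi n)]) ->
        exists (rho : R) (rhohat rho_pi : nat -> R),
          [/\ forall x0, opt_cost M x0 = rho%:E,
              forall n, (1 <= n)%N -> forall x0,
                opt_cost (approx_mdp M (Q n)) x0 = (rhohat n)%:E,
              forall n, (1 <= n)%N -> forall x0,
                avg_cost M x0 (stationary (pi n)) = (rho_pi n)%:E
            & rho_pi n @[n --> \oo] --> rho]].
Proof.
have nu_gt0 (nu : {measure set X -> \bar R}) : minorization M nu ->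
    0 < fine (nu [set: X]).
  move=> [nu0 nuM]; apply: fine_gt0; rewrite nu0/=.
  apply: le_lt_trans (nuM point _ measurableT) _.
  by have -> : trans M point [set: X] = 1%E by [exact: prob_kernel]; rewrite ltry.
split.
- move=> Q Kc KT lip KT1; have bc := lipschitz_bounded_cost lip.
  (* The zero measure minorizes, which makes k = 1 and the contraction condition
     for delta = 1 read KT < 1. *)
  have [zM z0] : minorized M (mzero : {measure set X -> \bar R}) /\
      fine ((mzero : {measure set X -> \bar R}) [set: X]) = 0.
    by split => // xu B mB; exact: measure_ge0.
  have k0 : 0 < 1 - fine ((mzero : {measure set X -> \bar R}) [set: X]).
    by rewrite z0 subr0.
  have d01 : 0 < (1 : R) <= 1 by rewrite ltr01 lexx.
  have KTk : KT < (1 / (1 - fine ((mzero : {measure set X -> \bar R}) [set: X])))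
      `^ ((1 - 1) / 1) by rewrite subrr mul0r powRr0.
  have sol := lipschitz_common_solution Q lip zM k0 d01 KTk.
  have [rho [rhoE rhoQ]] := opt_cost_gap bc (bounded_approx_cost Q bc) sol.
  exists rho; split=> // x0; apply: le_trans (rhoQ x0) _; rewrite lee_fin.
  rewrite subrr !powRr0 !mulr1 (powRr1 (max_quant_err_ge0 Q compactX)).
  case: (lipschitz_constants_max0 lip) => [[_ KTE]|->]; last by rewrite !mulr0.
  by rewrite powRr1// -KTE le_max lexx orbT.
- move=> Q nu Kc KT D L kappa minor k0 lip.
  have bc := lipschitz_bounded_cost lip.
  have nu0 := nu_gt0 _ minor; have [_ nuM] := minor.
  have bcQ := bounded_approx_cost Q bc.
  have nuMQ := minorized_approx Q nuM.
  have [rho rhoE] := minorized_opt_cost finiteU bc nuM nu0.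
  have [rhohat rhohatE] := minorized_opt_cost finiteU bcQ nuMQ nu0.
  exists rho, rhohat; split=> // [delta d01 KTk|pihat _ acoe].
    have sol := lipschitz_common_solution Q lip nuM k0 d01 KTk.
    have [rho' [rho'E /(_ point)]] := opt_cost_gap bc bcQ sol.
    have -> : rho' = rho by apply: EFin_inj; rewrite -(rho'E point).
    by rewrite rhohatE -EFinB lee_fin.
  have [rho_pi rho_piE] := minorized_avg_cost finiteU pihat bc nuM nu0.
  exists rho_pi; split=> // delta d01 KTk.
  have sol := lipschitz_common_solution Q lip nuM k0 d01 KTk.
  apply: le_trans (policy_gap bc nuMQ nu0 sol rhoE acoe rho_piE) _.
  rewrite le_eqVlt; apply/orP; left; apply/eqP.
  rewrite /L /D -/kappa (_ : 1 - kappa = fine (nu [set: X])); last first.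
    by rewrite /kappa; ring.
  by rewrite invfM; ring.
- move=> nu minor k0 wc Q pi hQ.
  have nu0 := nu_gt0 _ minor; have [_ nuM] := minor.
  have bc := weak_bounded_cost wc.
  have [rho rhoE] := minorized_opt_cost finiteU bc nuM nu0.
  have /choice[rhohat rhohatE] n : exists rhohat, forall x0,
      opt_cost (approx_mdp M (Q n)) x0 = rhohat%:E.
    apply: (minorized_opt_cost finiteU (bounded_approx_cost (Q n) bc) _ nu0).
    exact: minorized_approx.
  have /choice[rho_pi rho_piE] n : exists rho_pi, forall x0,
      avg_cost M x0 (stationary (pi n)) = rho_pi%:E.
    exact: minorized_avg_cost nuM nu0.
  exists rho, rhohat, rho_pi; split=> //.
  apply: (near_optimal_policies wc nuM nu0 (Q := Q) (pi := pi)) => //.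
    by move=> n /hQ[].
  by move=> n /hQ[].
Qed.
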